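(* Let $K$ be a field, $S=K[x_1,\dots,x_n]$, and let $I\subseteq S$ be a right PLP-polymatroidal ideal with data $k$, $d$, $\alpha_1,\dots,\alpha_k$, $\beta_1,\dots,\beta_k$, $b_{k+1},\dots,b_n$. Let $\mathbf b([k+1,n])=b_{k+1}+\cdots+b_n$. (a) If $d=\beta_k+\mathbf b([k+1,n])$, then $\operatorname{dstab}(I)=1$. (b) Set $\delta=\lfloor\frac{\alpha_k}{\beta_k}\rfloor$. If $d<\beta_k+\mathbf b([k+1,n])$, then $\operatorname{dstab}(I)=\Big\lceil\frac{n-k-\delta}{\beta_k+\mathbf b([k+1,n])-d}\Big\rceil$.
   Context: $\lfloor a\rfloor$ and $\lceil a\rceil$ denote the lower and upper integer part of a real number $a$. For a monomial ideal $I\subseteq S$, $\operatorname{dstab}(I)$ is the smallest integer $m$ with the property that $\operatorname{depth} S/I^m=\operatorname{depth} S/I^\ell$ for all $\ell\ge m$. Right PLP-polymatroidal ideal: let $n,k,d$ be positive integers with $1\le k\le n-1$, let $\alpha_i,\beta_i$ $(1\le i\le k)$ be non-negative integers with $\alpha_i\le\beta_i$ for all $i$, $\alpha_1\le\cdots\le\alpha_k\le d$, $0<\beta_1\le\cdots\le\beta_k\le d$, and let $b_{k+1},\dots,b_n$ be positive integers with $d\le\beta_k+b_{k+1}+\cdots+b_n$. The corresponding right PLP-polymatroidal ideal $I$ is the (nonzero) monomial ideal of $S$ generated by all $x_1^{u_1}\cdots x_n^{u_n}$, with $u_i$ non-negative integers, such that $\alpha_i\le u_1+\cdots+u_i\le\beta_i$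 for $i=1,\dots,k$, $0\le u_i\le b_i$ for $i=k+1,\dots,n$, and $u_1+\cdots+u_n=d$.
   Formalization: In (b), dstab(I) is the maximum of 1 and the printed ceiling; this differs only when n = k+1 and α_k = β_k, where the printed value is 0 although dstab(I) = 1 (e.g. n=2, k=d=α_1=β_1=b_2=1, I=(x_1)). *)

(* Defs.v *)
From HB Require Import structures.
From mathcomp Require Import all_boot all_order all_algebra.
From mathcomp Require Import mpoly.

Set Implicit Arguments.
Unset Strict Implicit.
Unset Printing Implicit Defensive.

Import Order.TTheory GRing.Theory Num.Theory.
Local Open Scope ring_scope.

(* Ideals are Prop-valued predicates on the ring. *)
Section Ideals.
Variable R : comNzRingType.

Definition ideal_gen (G : R -> Prop) (f : R) : Prop :=
  exists s : seq (R * R),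
    (forall p, p \in s -> G p.2) /\ f = \sum_(p <- s) p.1 * p.2.

(* For m = 0 the only generator is the empty product, so I^0 = R. *)
Definition ideal_pow (I : R -> Prop) (m : nat) : R -> Prop :=
  ideal_gen (fun f => exists s : m.-tuple R,
    (forall g, g \in s -> I g) /\ f = \prod_(g <- s) g).

Definition ideal_add_seq (J : R -> Prop) (fs : seq R) : R -> Prop :=
  ideal_gen (fun g => J g \/ g \in fs).

(* f is a nonzerodivisor on R/J. *)
Definition regular_mod (J : R -> Prop) (f : R) : Prop :=
  forall g, J (f * g) -> J g.

(* fs is an (R/J)-regular sequence consisting of elements of the ideal M. *)
Definition regular_seq (M J : R -> Prop) (fs : seq R) : Prop :=
  [/\ forall f, f \in fs -> M f,
      forall i, (i < size fs)%N ->
        regular_mod (ideal_add_seq J (take i fs)) fs`_i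
    & ~ ideal_add_seq J fs 1].

(* r is the greatest length of an (R/J)-regular sequence in M.  No r
   qualifies if R/J = 0. *)
Definition is_depth (M J : R -> Prop) (r : nat) : Prop :=
  (exists2 fs, regular_seq M J fs & size fs = r) /\
  (forall fs, regular_seq M J fs -> (size fs <= r)%N).

End Ideals.

Section Polynomials.
Variables (K : fieldType) (n : nat).

Definition max_ideal : {mpoly K[n]} -> Prop :=
  ideal_gen (fun f => exists i : 'I_n, f = 'X_i).

Definition is_depth_quot (J : {mpoly K[n]} -> Prop) (r : nat) : Prop :=
  is_depth max_ideal J r.

Definition depth_stable_from (I : {mpoly K[n]} -> Prop) (m : nat) : Prop :=
  exists r, forall l, (m <= l)%N -> is_depth_quot (ideal_pow I l) r.

(* Only powers I^m with m >= 1 are considered, since S/I^0 = 0. *)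
Definition is_dstab (I : {mpoly K[n]} -> Prop) (m : nat) : Prop :=
  [/\ (0 < m)%N, depth_stable_from I m
    & forall m', (0 < m')%N -> depth_stable_from I m' -> (m <= m')%N].

End Polynomials.

(* The families alpha, beta, b are indexed from 1; only alpha i, beta i for
   1 <= i <= k and b j for k + 1 <= j <= n are ever used. *)
Definition bsum (n k : nat) (b : nat -> nat) : nat :=
  (\sum_(k.+1 <= j < n.+1) b j)%N.

Record right_PLP_data (n k d : nat) (alpha beta b : nat -> nat) : Prop := {
  PLP_k : (1 <= k < n)%N;
  PLP_d : (0 < d)%N;
  PLP_alpha_beta : forall i, (1 <= i <= k)%N -> (alpha i <= beta i)%N;
  PLP_alpha_mono :
    forall i j, (1 <= i)%N -> (i <= j <= k)%N -> (alpha i <= alpha j)%N;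
  PLP_alpha_d : (alpha k <= d)%N;
  PLP_beta_gt0 : (0 < beta 1)%N;
  PLP_beta_mono :
    forall i j, (1 <= i)%N -> (i <= j <= k)%N -> (beta i <= beta j)%N;
  PLP_beta_d : (beta k <= d)%N;
  PLP_b_gt0 : forall j, (k < j <= n)%N -> (0 < b j)%N;
  PLP_d_le : (d <= beta k + bsum n k b)%N
}.

(* The ordinal j : 'I_n stands for the variable x_(j+1). *)
Definition right_PLP_exponent (n k d : nat) (alpha beta b : nat -> nat)
    (u : 'X_{1..n}) : Prop :=
  [/\ forall i, (1 <= i <= k)%N ->
        (alpha i <= \sum_(j < n | j < i) u j <= beta i)%N,
      forall j : 'I_n, (k <= j)%N -> (u j <= b j.+1)%N
    & (\sum_(j < n) u j = d)%N].

Definition right_PLP_ideal (K : fieldType) (n k d : nat)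
    (alpha beta b : nat -> nat) : {mpoly K[n]} -> Prop :=
  ideal_gen (fun f => exists2 u : 'X_{1..n},
    right_PLP_exponent k d alpha beta b u & f = 'X_[u]).

Arguments right_PLP_ideal K n k d alpha beta b : clear implicits.

(* Main.v *)
Require Import Defs.
From HB Require Import structures.
From mathcomp Require Import all_boot all_order all_algebra.
From mathcomp Require Import mpoly.
From mathcomp Require Import ring zify.

Set Implicit Arguments.
Unset Strict Implicit.
Unset Printing Implicit Defensive.

Import Order.TTheory GRing.Theory Num.Theory.
Local Open Scope ring_scope.

(* The partial sums [U_i = u_1 + ... + u_i] of the exponents of the generators
   satisfy [A_i <= U_i <= B_i] and [u_j <= b_j] for suitable [A], [B], [b], and
   the powers [I^l] are described by [l A], [l B], [l b].  Call [0 < i < n] a cut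
   if [A_i = B_i] and let [c] be the number of cuts; these do not depend on [l].

   Lower bound.  Deciding greedily whether a monomial lies in [I^l] filters
   [S/I^l] by quotients of [S] by sets of variables, on all of which the forms
   [x_i - x_(i+1)], [i] a cut, form a regular sequence; so the depth is at
   least [c].  If [d < beta_k + b([k+1,n])] but
   [l (beta_k + b([k+1,n]) - d) < n - k - delta], the sum [x_p + ... + x_n] with
   [p = k + delta] extends the sequence, and the depth is at least [c + 1].

   Upper bound.  Otherwise there is a monomial [w] such that [w] times one
   variable from each block between consecutive cuts always lies in [I^l], but
   has too small a degree as soon as one of the variables is left out.
   Multiplying [w] by the forms [sum_(j in block) x_j e_j] of all blocks but the
   first yields a nonzero Koszul cohomology class of [S/I^l] in degree [c], and
   each element of a regular sequence lowers this degree by one. *)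

(** * Regular sequences *)

Section WeakRegularity.
Variable R : comNzRingType.
Implicit Types (J : R -> Prop) (fs : seq R).

Definition is_ideal J : Prop :=
  [/\ J 0, forall f g, J f -> J g -> J (f + g) & forall a f, J f -> J (a * f)].

(** For an ideal [J] this is [J + (f)]. Adjoining one element at a time suits inductions along a
    sequence. *)
Definition ideal_add1 J (f g : R) : Prop := exists a, J (g - a * f).

Fixpoint ideal_adds J fs : R -> Prop :=
  if fs is f :: fs' then ideal_adds (ideal_add1 J f) fs' else J.

(** Here [J + (fs)] may be the whole ring, as happens for some pieces of the filtration used
    later. *)
Fixpoint weakly_regular J fs : Prop :=
  if fs is f :: fs' then regular_mod J f /\ weakly_regular (ideal_add1 J f) fs'
  else True.

Lemma ideal_opp J f : is_ideal J -> J f -> J (- f).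
Proof. by case=> _ _ JM Jf; rewrite -mulN1r; apply: JM. Qed.

Lemma ideal_sub J f g : is_ideal J -> J f -> J g -> J (f - g).
Proof. by move=> iJ Jf Jg; case: (iJ) => _ JD _; apply: JD => //; apply: ideal_opp. Qed.

Lemma ideal_sum J (I : Type) (r : seq I) (P : pred I) (F : I -> R) :
  is_ideal J -> (forall i, P i -> J (F i)) -> J (\sum_(i <- r | P i) F i).
Proof. by case=> J0 JD _ JF; elim/big_rec: _ => // i x /JF Ji Jx; apply: JD. Qed.

Lemma ideal_genP (G : R -> Prop) : is_ideal (ideal_gen G).
Proof.
split.
- by exists [::]; rewrite big_nil.
- move=> _ _ [s [Gs ->]] [t [Gt ->]]; exists (s ++ t); rewrite big_cat; split=> // p.
  by rewrite mem_cat => /orP[/Gs|/Gt].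
- move=> a _ [s [Gs ->]]; exists [seq (a * p.1, p.2) | p <- s]; split.
    by move=> p /mapP[q qs ->]; exact: (Gs q qs).
  by rewrite mulr_sumr big_map; apply: eq_bigr => p _; rewrite mulrA.
Qed.

Lemma ideal_gen_sub (G J : R -> Prop) :
  is_ideal J -> (forall f, G f -> J f) -> forall f, ideal_gen G f -> J f.
Proof.
move=> iJ GJ _ [s [Gs ->]]; rewrite big_seq.
by apply: ideal_sum => // p /Gs/GJ Jp; case: iJ => _ _ JM; apply: JM.
Qed.

Lemma mem_ideal_gen (G : R -> Prop) f : G f -> ideal_gen G f.
Proof.
by move=> Gf; exists [:: (1, f)]; rewrite big_seq1 /= mul1r; split=> // p /[!inE]/eqP->.
Qed.

Lemma ideal_add1P J f : is_ideal J -> is_ideal (ideal_add1 J f).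
Proof.
case=> J0 JD JM; split.
- by exists 0; rewrite mul0r subr0.
- move=> g h [a Ja] [b Jb]; exists (a + b).
  have -> : g + h - (a + b) * f = (g - a * f) + (h - b * f) by ring.
  exact: JD.
- move=> a g [b Jb]; exists (a * b).
  have -> : a * g - a * b * f = a * (g - b * f) by ring.
  exact: JM.
Qed.

Lemma ideal_addsP J fs : is_ideal J -> is_ideal (ideal_adds J fs).
Proof. by elim: fs J => //= f fs IH J iJ; apply: IH; apply: ideal_add1P. Qed.

Lemma sub_ideal_add1 J f g : J g -> ideal_add1 J f g.
Proof. by exists 0; rewrite mul0r subr0. Qed.

Lemma sub_ideal_adds J fs g : J g -> ideal_adds J fs g.
Proof. by elim: fs J => //= f fs IH J Jg; apply: IH; apply: sub_ideal_add1. Qed.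

Lemma mem_ideal_add1 J f : is_ideal J -> ideal_add1 J f f.
Proof. by case=> J0 _ _; exists 1; rewrite mul1r subrr. Qed.

Lemma ideal_add1_sub J J' f : is_ideal J' -> (forall g, J g -> J' g) -> J' f ->
  forall g, ideal_add1 J f g -> J' g.
Proof.
move=> [_ J'D J'M] JJ' J'f g [a Ja]; rewrite -(subrK (a * f) g).
by apply: J'D; [apply: JJ' | apply: J'M].
Qed.

Lemma mem_ideal_adds J fs f : is_ideal J -> f \in fs -> ideal_adds J fs f.
Proof.
elim: fs J => //= g fs IH J iJ; rewrite inE => /predU1P[->|].
  by apply: sub_ideal_adds; apply: mem_ideal_add1.
by apply: IH; apply: ideal_add1P.
Qed.

Lemma ideal_adds_sub J J' fs : is_ideal J' -> (forall g, J g -> J' g) ->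
  (forall f, f \in fs -> J' f) -> forall g, ideal_adds J fs g -> J' g.
Proof.
move=> iJ'; elim: fs J => [|f fs IH] //= J JJ' J'fs.
apply: IH => [|g gfs]; last by apply: J'fs; rewrite inE gfs orbT.
by apply: ideal_add1_sub => //; apply: J'fs; rewrite mem_head.
Qed.

Lemma ideal_add_seqE J fs g : is_ideal J ->
  ideal_add_seq J fs g <-> ideal_adds J fs g.
Proof.
move=> iJ; split.
  apply: ideal_gen_sub; first exact: ideal_addsP.
  by move=> f [/sub_ideal_adds|/(mem_ideal_adds iJ)]; apply.
apply: ideal_adds_sub; first exact: ideal_genP.
  by move=> f Jf; apply: mem_ideal_gen; left.
by move=> f ffs; apply: mem_ideal_gen; right.
Qed.

Lemma weakly_regularP J fs : weakly_regular J fs <->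
  forall i, (i < size fs)%N -> regular_mod (ideal_adds J (take i fs)) fs`_i.
Proof.
elim: fs J => [|f fs IH] J /=; first by split.
rewrite IH; split=> [[Hf Hfs] [|i] //=|H]; first by apply: Hfs.
by split=> [|i ilt]; [apply: (H 0%N) | apply: (H i.+1)].
Qed.

Lemma regular_mod_iff J J' f : (forall g, J g <-> J' g) ->
  regular_mod J f -> regular_mod J' f.
Proof. by move=> JJ' H g /JJ' /H /JJ'. Qed.

Lemma ideal_add1_iff J J' f : (forall g, J g <-> J' g) ->
  forall g, ideal_add1 J f g <-> ideal_add1 J' f g.
Proof. by move=> JJ' g; split=> -[a /JJ' Ja]; exists a. Qed.

Lemma weakly_regular_iff J J' fs : (forall g, J g <-> J' g) ->
  weakly_regular J fs -> weakly_regular J' fs.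
Proof.
elim: fs J J' => //= f fs IH J J' JJ' [Hf /IH Hfs]; split.
  exact: regular_mod_iff Hf.
by apply: Hfs; apply: ideal_add1_iff.
Qed.

Lemma regular_seqP (M : R -> Prop) J fs : is_ideal J ->
  regular_seq M J fs <->
  [/\ forall f, f \in fs -> M f, weakly_regular J fs & ~ ideal_adds J fs 1].
Proof.
move=> iJ; split=> -[HM H H1]; split=> //.
- apply/weakly_regularP => i /H; apply: regular_mod_iff => g.
  exact: ideal_add_seqE.
- by move=> H2; apply: H1; apply/(ideal_add_seqE fs 1 iJ).
- move=> i ilt; have /weakly_regularP/(_ i ilt) := H; apply: regular_mod_iff => g.
  by split=> /(ideal_add_seqE (take i fs) g iJ).
- by move=> H2; apply: H1; apply/(ideal_add_seqE fs 1 iJ).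
Qed.

(* The exact sequence [0 -> R/(J : w) -> R/J -> R/(J + w) -> 0]. *)
Lemma weakly_regular_ext J J1 J2 w fs : is_ideal J ->
  (forall g, J1 g <-> J (w * g)) -> (forall g, J2 g <-> ideal_add1 J w g) ->
  weakly_regular J1 fs -> weakly_regular J2 fs -> weakly_regular J fs.
Proof.
elim: fs J J1 J2 => //= f fs IH J J1 J2 iJ J1E J2E [r1 H1] [r2 H2].
have [J0 JD JM] := iJ.
split.
  move=> g Jfg; have /r2 /J2E [h Jh] : J2 (f * g).
    by apply/J2E/sub_ideal_add1.
  have /r1 /J1E Jwh : J1 (f * h).
    apply/J1E; have -> : w * (f * h) = f * g - f * (g - h * w) by ring.
    by apply: ideal_sub => //; apply: JM.
  by rewrite -(subrK (h * w) g) mulrC; apply: JD => //; rewrite mulrC.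
(* [(J + f) : w = (J : w) + f]; the inclusion from left to right uses that [f] is regular modulo
   [J + w]. *)
apply: (IH _ (ideal_add1 J1 f) (ideal_add1 J2 f)) => //; first exact: ideal_add1P.
- move=> g; split.
    move=> [a /J1E Ja]; exists (w * a).
    by rewrite -mulrA -mulrBr.
  move=> [a Ja]; have /r2 /J2E [h Jh] : J2 (f * a).
    apply/J2E; exists g; rewrite -opprB; apply: ideal_opp => //.
    by rewrite [g * w]mulrC [f * a]mulrC.
  exists h; apply/J1E.
  have -> : w * (g - h * f) = (w * g - a * f) + f * (a - h * w) by ring.
  by apply: JD => //; apply: JM.
- move=> g; split.
    move=> [a /J2E [c Jc]]; exists c; exists a.
    by rewrite addrAC.
  move=> [c [a Ja]]; exists a; apply/J2E; exists c.
  by rewrite addrAC.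
Qed.

Lemma is_depth_uniq (M J : R -> Prop) r s : is_depth M J r -> is_depth M J s -> r = s.
Proof.
move=> [[fs Hfs <-] Hr] [[gs Hgs <-] Hs]; apply/eqP; rewrite eqn_leq.
by rewrite Hs // Hr.
Qed.

End WeakRegularity.

(** * Koszul cohomology *)

Section Koszul.
Variables (R : comNzRingType) (I : finType).
Implicit Types (a : I -> R) (z : seq I -> R) (w : seq I) (J : R -> Prop).

(* The Koszul differential on cochains that need not be alternating; with
   [a = x] the usual differential, in general exterior multiplication by [a]. *)
Fixpoint koszul a w z : R :=
  if w is j :: w' then a j * z w' - koszul a w' (fun v => z (j :: v)) else 0.

Lemma eq_koszul a w z z' : z =1 z' -> koszul a w z = koszul a w z'.
Proof.
elim: w z z' => //= j w IH z z' zz'; rewrite zz'.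
by congr (_ - _); apply: IH => v; apply: zz'.
Qed.

Lemma koszulB a w z z' : koszul a w (fun v => z v - z' v) = koszul a w z - koszul a w z'.
Proof.
elim: w z z' => [|j w IH] z z' /=; first by rewrite subr0.
by rewrite (IH (fun v => z (j :: v)) (fun v => z' (j :: v))); ring.
Qed.

Lemma koszulZ a w c z : koszul a w (fun v => c * z v) = c * koszul a w z.
Proof.
elim: w z => [|j w IH] z /=; first by rewrite mulr0.
by rewrite (IH (fun v => z (j :: v))); ring.
Qed.

Lemma koszul_anticomm a b w z :
  koszul a w (fun v => koszul b v z) = - koszul b w (fun v => koszul a v z).
Proof.
elim: w z => [|j w IH] z /=; first by rewrite oppr0.
rewrite !koszulB !koszulZ IH; ring.
Qed.

Lemma koszul_sqr0 a w z : koszul a w (fun v => koszul a v z) = 0.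
Proof.
elim: w z => [|j w IH] z //=; rewrite !koszulB !koszulZ IH; ring.
Qed.

Lemma koszul_sum (T : Type) (r : seq T) (s : T -> R) (F : T -> I -> R) w z :
  koszul (fun i => \sum_(t <- r) s t * F t i) w z = \sum_(t <- r) s t * koszul (F t) w z.
Proof.
elim: w z => [|j w IH] z /=.
  by rewrite big1 // => t _; rewrite mulr0.
rewrite IH mulr_suml -sumrB; apply: eq_bigr => t _; ring.
Qed.

Lemma eq_koszull a b w z : a =1 b -> koszul a w z = koszul b w z.
Proof. by move=> ab; elim: w z => //= j w IH z; rewrite ab IH. Qed.

Lemma koszul0 a w z : (forall i, i \in w -> a i = 0) -> koszul a w z = 0.
Proof.
elim: w z => //= j w IH z a0; rewrite a0 ?mem_head // mul0r IH ?subrr //.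
by move=> i iw; apply: a0; rewrite inE iw orbT.
Qed.

Lemma koszul_ideal J a w z : is_ideal J ->
  (forall i v, i \in w -> size v = (size w).-1 -> J (a i * z v)) -> J (koszul a w z).
Proof.
move=> iJ; elim: w z => [|j w IH] z H /=; first by case: iJ.
apply: ideal_sub => //; first by apply: H; rewrite ?mem_head.
apply: IH => i v iw vw; apply: H; first by rewrite inE iw orbT.
by rewrite /= vw; case: (w) iw.
Qed.

(** Cartan's formula: with [d] the differential and [i_r] the contraction with [r], [d i_r + i_r d]
    is multiplication by [\sum_p p.1 * x p.2]. *)
Lemma koszul_contract x (r : seq (R * I)) w z :
  koszul x w (fun v => \sum_(p <- r) p.1 * z (p.2 :: v)) =
  \sum_(p <- r) p.1 * (x p.2 * z w - koszul x (p.2 :: w) z).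
Proof.
elim: r => [|p r IH].
  rewrite big_nil -[RHS](mul0r (koszul x w z)) -koszulZ.
  by apply: eq_koszul => v; rewrite big_nil mul0r.
rewrite big_cons -IH.
have -> : koszul x w (fun v => \sum_(q <- p :: r) q.1 * z (q.2 :: v)) =
  koszul x w (fun v => p.1 * z (p.2 :: v) - (-1) * (\sum_(q <- r) q.1 * z (q.2 :: v))).
  by apply: eq_koszul => v; rewrite big_cons; ring.
rewrite koszulB !koszulZ /=; ring.
Qed.

(** A nonzero class of degree [c] in the Koszul cohomology of [R/J], with cochains on all words of
    length [c]. *)
Definition koszul_class (x : I -> R) J (c : nat) : Prop :=
  exists z, (forall w, size w = c.+1 -> J (koszul x w z)) /\
    ~ exists y, forall w, size w = c -> J (z w - koszul x w y).

(* Contraction along [f = \sum_p p.1 * x p.2] is a homotopy for multiplication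
   by [f]; so a regular [f] lowers the degree of a class. *)
Lemma koszul_class_reg x J c (r : seq (R * I)) f : is_ideal J ->
  f = \sum_(p <- r) p.1 * x p.2 -> regular_mod J f -> koszul_class x J c ->
  exists2 c', c = c'.+1 & koszul_class x (ideal_add1 J f) c'.
Proof.
move=> iJ fE reg [z [zcyc znb]].
pose y v := \sum_(p <- r) p.1 * z (p.2 :: v).
have yE w : size w = c -> J (f * z w - koszul x w y).
  move=> wc; rewrite koszul_contract fE mulr_suml -sumrB.
  apply: ideal_sum => // p _.
  have -> : p.1 * x p.2 * z w - p.1 * (x p.2 * z w - koszul x (p.2 :: w) z) =
     p.1 * koszul x (p.2 :: w) z by ring.
  by case: iJ => _ _; apply; apply: zcyc; rewrite /= wc.
case: c => [|c] in zcyc znb yE *.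
  (* In degree zero [koszul x [::] y] vanishes, so [f * z] and hence [z] lies in [J]. *)
  case: znb; exists (fun=> 0) => w w0; apply: reg.
  have {w0}-> : w = [::] by case: w w0.
  by have := yE [::] erefl; rewrite /= !subr0.
exists c => //; exists y; split.
  by move=> w wc; exists (z w); rewrite -opprB mulrC; apply: ideal_opp => //; apply: yE.
move=> [u uE]; case: znb.
(* If [y = d u + f v] modulo [J], then [f (z - d v) = d (y - d u - f v) = 0] modulo [J], so
   [z = d v] modulo [J] by regularity. *)
suff [v vE] : exists v, forall w, size w = c -> J (y w - koszul x w u - v w * f).
  exists v => w wc; apply: reg.
  have -> : f * (z w - koszul x w v) = (f * z w - koszul x w y) +
     koszul x w (fun w' => (y w' - koszul x w' u) - f * v w').
    by rewrite koszulB koszulB koszul_sqr0 koszulZ; ring.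
  case: (iJ) => _ JD JM; apply: JD; first exact: yE.
  apply: koszul_ideal => // i v' _ v'c.
  by apply: JM; rewrite [f * _]mulrC; apply: vE; rewrite v'c wc.
have /fin_all_exists[v vE] (t : c.-tuple I) : exists b, J (y t - koszul x t u - b * f).
  by have [b Jb] := uE t (size_tuple t); exists b.
exists (fun w => if insub w is Some t then v t else 0) => w wc.
by case: insubP => [t _ <-|]; [exact: vE | rewrite wc eqxx].
Qed.


(** Each element of the sequence moves the class down by one degree, which is impossible in degree
    zero. *)
Lemma koszul_class_bound x J c fs : is_ideal J ->
  (forall f, f \in fs -> ideal_gen (fun g => exists i, g = x i) f) ->
  weakly_regular J fs -> koszul_class x J c -> (size fs <= c)%N.
Proof.
elim: fs J c => //= f fs IH J c iJ fsM [fr fsr] cl.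
have [s [sx fE]] := fsM f (mem_head _ _).
have {s sx fE}[r fE] : exists r : seq (R * I), f = \sum_(p <- r) p.1 * x p.2.
  rewrite {}fE; elim: s sx => [|[a g] s IHs] sx.
    by exists [::]; rewrite !big_nil.
  have [i /= gE] := sx _ (mem_head _ _).
  have [|r rE] := IHs; first by move=> p ps; apply: sx; rewrite inE ps orbT.
  by exists ((a, i) :: r); rewrite !big_cons rE /= gE.
have [c' -> cl'] := koszul_class_reg iJ fE fr cl.
apply: IH cl' => //; first exact: ideal_add1P.
by move=> g gfs; apply: fsM; rewrite inE gfs orbT.
Qed.

(* Iterated exterior product of the one-forms [F t], [t \in ts], with [c]. *)
Definition koszul_prod (F : nat -> I -> R) (c : R) (ts : seq nat) : seq I -> R :=
  foldr (fun t z w => koszul (F t) w z) (fun w => if w is [::] then c else 0) ts.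

Lemma koszul_prod_mul0 F c ts t w : t \in ts -> koszul (F t) w (koszul_prod F c ts) = 0.
Proof.
elim: ts w => //= s ts IH w; rewrite inE => /predU1P[->|tts].
  exact: koszul_sqr0.
rewrite koszul_anticomm -[RHS]oppr0 -(mul0r (koszul (F s) w (koszul_prod F c ts))) -koszulZ.
by congr (- _); apply: eq_koszul => v; rewrite IH // mul0r.
Qed.

Lemma koszul_prod_ideal (i0 : I) J F c ts w : is_ideal J -> uniq ts ->
  (forall f : nat -> I, J (c * \prod_(t <- ts) F t (f t))) ->
  size w = size ts -> J (koszul_prod F c ts w).
Proof.
elim: ts J w => [|t ts IH] J w iJ /=.
  by move=> _ /(_ (fun=> i0)); rewrite big_nil mulr1 => Jc /size0nil ->.
case/andP=> tts uts H wt; have [J0 JD JM] := iJ.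
apply: koszul_ideal => // i v _; rewrite wt /= => vt.
(* The factor [F t i] is moved into the ideal: the induction continues with the colon ideal
   [J : F t i]. *)
apply: (IH (fun g => J (F t i * g))) => // [|f].
  split=> [|f g Jf Jg|a f Jf]; first by rewrite mulr0.
    by rewrite mulrDr; apply: JD.
  by rewrite mulrCA; apply: JM.
have := H (fun s => if s == t then i else f s).
rewrite big_cons eqxx mulrCA; congr (J (_ * (_ * _))).
apply: eq_big_seq => s sts; case: eqP => // st.
by rewrite -st sts in tts.
Qed.

(** The value is [c] times the determinant of the matrix [F s (r t)], which is diagonal here. *)
Lemma koszul_prod_diag F c ts (r : nat -> I) : uniq ts ->
  {in ts &, forall s t, s != t -> F s (r t) = 0} ->
  koszul_prod F c ts (map r ts) = c * \prod_(t <- ts) F t (r t).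
Proof.
elim: ts => [|t ts IH] /=; first by rewrite big_nil mulr1.
case/andP=> tts uts F0; rewrite IH //; last first.
  by move=> s u sts uts'; apply: F0; rewrite inE ?sts ?uts' orbT.
rewrite koszul0 ?subr0 ?big_cons; first by rewrite mulrCA.
move=> _ /mapP[s sts ->]; apply: F0; rewrite ?mem_head ?inE ?sts ?orbT //.
by apply: contraNneq tts => ->.
Qed.

Lemma koszul_functional (V : zmodType) (phi : {additive R -> V}) x w z :
  (forall i v, i \in w -> size v = (size w).-1 -> phi (x i * z v) = 0) ->
  phi (koszul x w z) = 0.
Proof.
elim: w z => [|j w IH] z H /=; first by rewrite raddf0.
rewrite raddfB /= H ?mem_head // IH ?subrr // => i v iw vw.
by apply: H; [rewrite inE iw orbT | rewrite /= vw; case: (w) iw].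
Qed.

(* The form [x] is split as [\sum_t s t * F t] and the class is the product of
   all [F t] but the first; it is detected on the word [map r ts] by [phi]. *)
Lemma koszul_class_prod (V : zmodType) (phi : {additive R -> V}) (x : I -> R) J
    (F : nat -> I -> R) (s : nat -> R) (c : R) (t0 : nat) ts (r : nat -> I) :
  is_ideal J -> uniq (t0 :: ts) ->
  (forall i, x i = \sum_(t <- t0 :: ts) s t * F t i) ->
  (forall f : nat -> I, J (c * \prod_(t <- t0 :: ts) F t (f t))) ->
  {in t0 :: ts &, forall u t, u != t -> F u (r t) = 0} ->
  (forall t g, t \in t0 :: ts -> J g -> phi (x (r t) * g) = 0) ->
  phi (s t0 * (c * \prod_(t <- t0 :: ts) F t (r t))) != 0 ->
  koszul_class x J (size ts).
Proof.
move=> iJ uts xE Jc F0 phi0 phin0; exists (koszul_prod F c ts).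
(* Every form but [F t0] already occurs in the product, so only the summand [s t0 * F t0] of [x]
   contributes to the differential. *)
have dE w : koszul x w (koszul_prod F c ts) = s t0 * koszul_prod F c (t0 :: ts) w.
  rewrite (eq_koszull _ _ xE) koszul_sum big_cons big_seq big1 ?addr0 // => t tts.
  by rewrite koszul_prod_mul0 ?mulr0.
split=> [w wts|[y yE]].
  rewrite dE; case: (iJ) => _ _; apply.
  exact: (koszul_prod_ideal (r 0%N)).
(* If the product were [d y] modulo [J], [phi] would kill its differential on the word
   [map r (t0 :: ts)], against [phin0]. *)
case/eqP: phin0; rewrite -koszul_prod_diag // -dE.
set w := map r _.
have -> : koszul x w (koszul_prod F c ts) =
    koszul x w (fun v => koszul_prod F c ts v - koszul x v y).
  by rewrite koszulB koszul_sqr0 subr0.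
apply: koszul_functional => _ v /mapP[t tts ->]; rewrite size_map /= => vts.
by apply: phi0 => //; apply: yE.
Qed.

End Koszul.

(** * Monomial ideals and linear forms *)

Section MonomialIdeals.
Variables (K : fieldType) (n : nat).
Notation S := {mpoly K[n]}.
Implicit Types (A : pred 'X_{1..n}) (m : 'X_{1..n}) (f g : S).

Definition mono_ideal A f : Prop := forall m, m \in msupp f -> A m.

Definition upset A : Prop := forall m m', A m -> A (m + m')%MM.

Lemma mono_idealP A : upset A -> is_ideal (mono_ideal A).
Proof.
move=> upA; split=> [m|f g Hf Hg m|a f Hf m].
- by rewrite msupp0.
- by move/msuppD_le; rewrite mem_cat => /orP[/Hf|/Hg].
- by move/msuppM_le/allpairsP => [[m1 m2] /= [_ /Hf Am2 ->]]; rewrite addmC; apply: upA.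
Qed.

Lemma mono_ideal_iff A A' : A =1 A' -> forall f, mono_ideal A f <-> mono_ideal A' f.
Proof. by move=> AA' f; split=> H m /H; rewrite AA'. Qed.

Lemma mono_idealX A m : mono_ideal A 'X_[m] <-> A m.
Proof.
split=> [|Am m']; first by apply; rewrite msuppX mem_head.
by rewrite msuppX inE => /eqP->.
Qed.

Lemma mono_ideal_sub A (J : S -> Prop) : is_ideal J ->
  (forall m, A m -> J 'X_[m]) -> forall f, mono_ideal A f -> J f.
Proof.
move=> iJ AJ f Af; rewrite (mpolyE f) big_seq; apply: ideal_sum => // m mf.
by rewrite -mul_mpolyC; case: iJ => _ _; apply; apply: AJ; apply: Af.
Qed.

Lemma mono_ideal_colon A i g :
  mono_ideal A ('X_i * g) <-> mono_ideal (fun m => A (m + U_(i))%MM) g.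
Proof.
have XgC : 'X_i * g = g * 'X_i by rewrite mulrC.
split=> H m mg.
  by apply: H; rewrite XgC addmC mcoeff_msupp mcoeffMX -mcoeff_msupp.
by move: mg; rewrite XgC (perm_mem (msuppMX _ _)) => /mapP[m' /H Am' ->]; rewrite addmC.
Qed.

Lemma mono_ideal_addX A i g : upset A ->
  mono_ideal (fun m => A m || (0 < m i)%N) g <-> ideal_add1 (mono_ideal A) 'X_i g.
Proof.
move=> upA; have iA := mono_idealP upA; split=> [H|[a Ha]].
  apply: mono_ideal_sub H => [|m /orP[Am|mi]]; first exact: ideal_add1P.
    by apply: sub_ideal_add1; apply/mono_idealX.
  exists 'X_[m - U_(i)]; rewrite -mpolyXD submK ?subrr; first by case: iA.
  by rewrite lep1mP -lt0n.
move=> m; rewrite -(subrK (a * 'X_i) g) => /msuppD_le; rewrite mem_cat.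
case/orP=> [/Ha -> //|]; rewrite (perm_mem (msuppMX _ _)) => /mapP[m' _ ->].
by rewrite mnmDE mnm1E eqxx orbT.
Qed.

Definition vars_upset (Z : {set 'I_n}) : pred 'X_{1..n} :=
  fun m => [exists z in Z, (0 < m z)%N].

Lemma vars_upsetP Z : upset (vars_upset Z).
Proof.
move=> m m' /exists_inP[z zZ mz]; apply/exists_inP; exists z => //.
by rewrite mnmDE addn_gt0 mz.
Qed.

(** Splits off one power of [x_i]: the two hypotheses concern [J : x_i] and [J + (x_i)]. *)
Lemma weakly_regular_step A i fs : upset A ->
  weakly_regular (mono_ideal (fun m => A (m + U_(i))%MM)) fs ->
  weakly_regular (mono_ideal (fun m => A m || (0 < m i)%N)) fs ->
  weakly_regular (mono_ideal A) fs.
Proof.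
move=> upA; apply: (@weakly_regular_ext _ _ _ _ 'X_i); first exact: mono_idealP.
  by move=> g; rewrite mono_ideal_colon.
by move=> g; apply: mono_ideal_addX.
Qed.

Definition linear_form f : Prop := exists a : 'I_n -> K, f = \sum_i a i *: 'X_i.

Lemma linear_form_sum (I : Type) (r : seq I) (a : I -> K) (F : I -> S) :
  (forall i, linear_form (F i)) -> linear_form (\sum_(i <- r) a i *: F i).
Proof.
move=> lF; elim: r => [|i r [b IH]].
  by exists (fun=> 0); rewrite big_nil big1 // => i _; rewrite scale0r.
have [c Fi] := lF i; exists (fun j => a i * c j + b j).
rewrite big_cons IH Fi scaler_sumr -big_split; apply: eq_bigr => j _.
by rewrite scalerDl scalerA.
Qed.

Lemma linear_formX i : linear_form 'X_i.
Proof.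
exists (fun j => (j == i)%:R); rewrite (bigD1 i) //= eqxx scale1r big1 ?addr0 //.
by move=> j /negbTE->; rewrite scale0r.
Qed.

Lemma linear_formB f g : linear_form f -> linear_form g -> linear_form (f - g).
Proof.
move=> [a ->] [b ->]; exists (fun i => a i - b i); rewrite -sumrB.
by apply: eq_bigr => i _; rewrite scalerBl.
Qed.

Lemma linear_formZ c f : linear_form f -> linear_form (c *: f).
Proof.
move=> [a ->]; exists (fun i => c * a i); rewrite scaler_sumr.
by apply: eq_bigr => i _; rewrite scalerA.
Qed.

Lemma linear_form_max_ideal f : linear_form f -> max_ideal f.
Proof.
move=> [a ->]; have iM := @ideal_genP S (fun f => exists i : 'I_n, f = 'X_i).
apply: ideal_sum => // i _; rewrite -mul_mpolyC; case: (iM) => _ _; apply.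
by apply: mem_ideal_gen; exists i.
Qed.

(* [Q] is the kernel of a substitution of linear forms for the variables;
   such an ideal is prime. *)
Definition linear_kernel (Q : S -> Prop) : Prop :=
  exists phi : {lrmorphism S -> S},
    [/\ forall i, linear_form (phi 'X_i), forall i, Q ('X_i - phi 'X_i)
      & forall h, Q h -> phi h = 0].

Lemma lrmorphZ (phi : {lrmorphism S -> S}) c f : phi (c *: f) = c *: phi f.
Proof. exact: linearZ. Qed.

(** Being fixed by [phi] modulo [Q] passes from the variables to products and linear
    combinations. *)
Lemma sub_lrmorphism (Q : S -> Prop) (phi : {lrmorphism S -> S}) h :
  is_ideal Q -> (forall i, Q ('X_i - phi 'X_i)) -> Q (h - phi h).
Proof.
move=> iQ Qphi; have [Q0 QD QM] := iQ.
have QMM f g : Q (f - phi f) -> Q (g - phi g) -> Q (f * g - phi (f * g)).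
  move=> Qf Qg; have -> : f * g - phi (f * g) = g * (f - phi f) + phi f * (g - phi g).
    by rewrite rmorphM /=; ring.
  by apply: QD; apply: QM.
have Q1 : Q (1 - phi 1) by rewrite rmorph1 subrr.
elim/mpolyind: h => [|c m p _ _ Qp]; first by rewrite raddf0 subrr.
rewrite raddfD /= opprD addrACA; apply: QD => //.
rewrite lrmorphZ -scalerBr -mul_mpolyC; apply: QM; rewrite mpolyXE_id.
elim/big_rec: _ => // i f _; apply: (QMM).
by elim: (m i) => [|k IH]; rewrite ?expr0 // exprS; apply: QMM.
Qed.

Lemma linear_form_lrmorphism (phi : {lrmorphism S -> S}) f :
  (forall i, linear_form (phi 'X_i)) -> linear_form f -> linear_form (phi f).
Proof.
move=> lphi [a ->]; rewrite raddf_sum /=.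
under eq_bigr do rewrite lrmorphZ.
exact: linear_form_sum.
Qed.

Lemma linear_kernel_regular (Q : S -> Prop) f : is_ideal Q -> linear_kernel Q ->
  linear_form f -> ~ Q f -> regular_mod Q f /\ linear_kernel (ideal_add1 Q f).
Proof.
move=> iQ [phi [lphi Qphi phi0]] lf Qf; have [Q0 QD QM] := iQ.
have phiQ h := sub_lrmorphism h iQ Qphi.
have Qker h : phi h = 0 -> Q h by move=> h0; have := phiQ h; rewrite h0 subr0.
have phif0 : phi f != 0 by apply/eqP => /Qker.
split=> [g /phi0|].
  by rewrite rmorphM => /eqP; rewrite mulf_eq0 (negbTE phif0) => /eqP/Qker.
have lphif := linear_form_lrmorphism lphi lf.
have [b bE] := lphif.
have [p bp] : exists p, b p != 0.
  apply/existsP; apply: contraNT phif0 => /existsPn b0.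
  by rewrite bE big1 // => i _; rewrite (eqP (negbNE (b0 i))) scale0r.
(* [rho] solves [phi f = 0] for a variable [x_p] that occurs in [phi f]; so it kills [phi f], and
   [rho \o phi] has kernel [Q + (f)]. *)
pose rt := [tuple 'X_i - ((i == p)%:R / b p) *: phi f | i < n].
pose rho : {lrmorphism S -> S} := comp_mpoly rt.
have rhoX i : rho 'X_i = 'X_i - ((i == p)%:R / b p) *: phi f.
  by rewrite /rho /= comp_mpolyXU -tnth_nth tnth_mktuple.
have rhof : rho (phi f) = 0.
  rewrite {1}bE raddf_sum /=; under eq_bigr do rewrite lrmorphZ rhoX scalerBr scalerA.
  rewrite sumrB -bE (bigD1 p) //= eqxx mul1r divff // scale1r big1 ?addr0 ?subrr //.
  by move=> i /negbTE->; rewrite mul0r mulr0 scale0r.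
have iQf := ideal_add1P f iQ; have [_ QfD QfM] := iQf.
have Qfphif : ideal_add1 Q f (phi f).
  by exists 1; rewrite mul1r -opprB; apply: ideal_opp.
have lrho i : linear_form (rho 'X_i).
  by rewrite rhoX; apply: linear_formB; [exact: linear_formX | exact: linear_formZ].
have Qrho h : ideal_add1 Q f (h - rho h).
  apply: sub_lrmorphism => // i; rewrite rhoX opprB addrC subrK.
  by rewrite -mul_mpolyC; apply: QfM.
exists (rho \o phi : {lrmorphism S -> S}); split=> [i|i|h] /=.
- by apply: linear_form_lrmorphism.
- rewrite -[X in X - _](subrK (phi 'X_i)) -addrA; apply: QfD; last exact: Qrho.
  exact: sub_ideal_add1.
- move=> [a /phi0]; rewrite raddfB /= rmorphM /= => /eqP; rewrite subr_eq0 => /eqP->.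
  by rewrite rmorphM /= rhof mulr0.
Qed.

Lemma linear_kernel_vars (Z : {set 'I_n}) : linear_kernel (mono_ideal (vars_upset Z)).
Proof.
have iZ := mono_idealP (@vars_upsetP Z).
pose rt := [tuple (if i \in Z then 0 else 'X_i : S) | i < n].
have rhoX i : 'X_i \mPo rt = if i \in Z then 0 else 'X_i.
  by rewrite comp_mpolyXU -tnth_nth tnth_mktuple.
exists (comp_mpoly rt : {lrmorphism S -> S}); split=> [i|i|h Hh] /=.
- rewrite rhoX; case: ifP => _; last exact: linear_formX.
  by exists (fun=> 0); rewrite big1 // => j _; rewrite scale0r.
- rewrite rhoX; case: ifP => iZ'; last by rewrite subrr; case: iZ.
  rewrite subr0; apply/mono_idealX/exists_inP; exists i => //.
  by rewrite mnm1E eqxx.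
- rewrite comp_mpolyE big_seq big1 // => m /Hh/exists_inP[z zZ mz].
  rewrite (bigD1 z) //= tnth_mktuple zZ expr0n.
  by rewrite eqn0Ngt mz mul0r scaler0.
Qed.

(** A triangular form of linear independence on the set of points [V]: each form is nonzero at a
    point of [V] where its predecessors vanish. *)
Fixpoint separated (V : ('I_n -> K) -> Prop) (fs : seq S) : Prop :=
  if fs is f :: fs' then
    (exists2 v, V v & f.@[v] != 0) /\ separated (fun v => V v /\ f.@[v] = 0) fs'
  else True.

(** As [Q] vanishes on [V], the separating point keeps [f] out of the prime [Q]. The next step
    replaces [Q] by [Q + (f)] and [V] by its points with [f = 0]. *)
Lemma separated_regular (Q : S -> Prop) (V : ('I_n -> K) -> Prop) fs :
  is_ideal Q -> linear_kernel Q -> (forall h v, Q h -> V v -> h.@[v] = 0) ->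
  (forall f, f \in fs -> linear_form f) -> separated V fs -> weakly_regular Q fs.
Proof.
elim: fs Q V => //= f fs IH Q V iQ lQ QV lfs [[v Vv fv] sep].
have [|fr lQf] := linear_kernel_regular iQ lQ (lfs f (mem_head _ _)).
  by move=> /QV/(_ Vv) fv0; rewrite fv0 eqxx in fv.
split=> //; apply: IH sep => //; first exact: ideal_add1P.
  move=> h u [a /QV Ha] [/Ha]; rewrite mevalB mevalM => /eqP.
  by rewrite subr_eq0 => /eqP-> ->; rewrite mulr0.
by move=> g gfs; apply: lfs; rewrite inE gfs orbT.
Qed.

Lemma vars_regular (Z : {set 'I_n}) fs :
  (forall f, f \in fs -> linear_form f) ->
  separated (fun v => forall z, z \in Z -> v z = 0) fs ->
  weakly_regular (mono_ideal (vars_upset Z)) fs.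
Proof.
move=> lfs; apply: separated_regular => //.
- exact: mono_idealP (@vars_upsetP Z).
- exact: linear_kernel_vars.
move=> h v Qh Vv; rewrite mevalE big_seq big1 // => m /Qh/exists_inP[z zZ mz].
by rewrite (bigD1 z) //= Vv // expr0n eqn0Ngt mz mul0r mulr0.
Qed.

End MonomialIdeals.

(** * Lattice path exponents *)

(** [b i] bounds the step from [i] to [i.+1]. The conditions make [A] and [B] themselves admissible
    paths with common endpoints; the final value is the degree. *)
Record lattice_path_data (n : nat) (A B b : nat -> nat) : Prop := {
  lpd_A0 : A 0%N = 0%N;
  lpd_B0 : B 0%N = 0%N;
  lpd_AB : forall i, (i <= n)%N -> (A i <= B i)%N;
  lpd_A_mono : forall i, (i < n)%N -> (A i <= A i.+1)%N;
  lpd_B_mono : forall i, (i < n)%N -> (B i <= B i.+1)%N;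
  lpd_A_step : forall i, (i < n)%N -> (A i.+1 <= A i + b i)%N;
  lpd_B_step : forall i, (i < n)%N -> (B i.+1 <= B i + b i)%N;
  lpd_last : A n = B n
}.

Lemma lattice_path_data_scale n A B b l : lattice_path_data n A B b ->
  lattice_path_data n (fun i => l * A i)%N (fun i => l * B i)%N (fun i => l * b i)%N.
Proof.
case=> A0 B0 AB Am Bm As Bs AnBn; split=> [||i /AB|i /Am|i /Bm|i /As|i /Bs|].
- by rewrite A0 muln0.
- by rewrite B0 muln0.
- exact: leq_mul.
- exact: leq_mul.
- exact: leq_mul.
- by rewrite -mulnDr; apply: leq_mul.
- by rewrite -mulnDr; apply: leq_mul.
- by rewrite AnBn.
Qed.

Definition path_exponent (n : nat) (A B b u : nat -> nat) : Prop :=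
  (forall i, (i <= n)%N -> (A i <= \sum_(0 <= j < i) u j <= B i)%N) /\
  (forall j, (j < n)%N -> (u j <= b j)%N).

(** * The greedy membership test *)

Section Greedy.
Variables (A B b : nat -> nat).
Implicit Types (f g : nat -> nat) (i r U : nat).

(* The partial sum reached at [i.+1] by an exponent below [f] that has partial
   sum [U] at [i] and is chosen as large as possible there. *)
Definition greedy_step f i U : nat := minn (U + minn (f i) (b i)) (B i.+1).

(** [r] further steps of the greedy run from the partial sum [U] at [i]; it fails once even the
    largest reachable sum is below [A]. *)
Fixpoint survives r i U f : bool :=
  if r is r'.+1 then
    (A i.+1 <= greedy_step f i U)%N && survives r' i.+1 (greedy_step f i U) f
  else true.

Lemma survives_eq r i U f g : (forall j, (i <= j)%N -> f j = g j) ->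
  survives r i U f = survives r i U g.
Proof.
elim: r i U => //= r IH i U fg; rewrite /greedy_step fg //.
by congr (_ && _); apply: IH => j ij; apply: fg; apply: ltnW.
Qed.

Lemma survives_mono r i U U' f g : (U <= U')%N ->
  (forall j, (i <= j < i + r)%N -> (f j <= g j)%N) ->
  survives r i U f -> survives r i U' g.
Proof.
elim: r i U U' => //= r IH i U U' UU' fg /andP[Af sf].
have fgi : (f i <= g i)%N by apply: fg; lia.
have le : (greedy_step f i U <= greedy_step g i U')%N by rewrite /greedy_step; lia.
rewrite (leq_trans Af le) /=; apply: IH le _ sf => j ij; apply: fg; lia.
Qed.

(** The greedy run stays above every admissible path below [f]. *)
Lemma survives_path r i f u U :
  (forall j, (i <= j < i + r)%N -> (u j <= f j)%N /\ (u j <= b j)%N) ->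
  (forall j, (j <= r)%N -> (A (i + j) <= U + \sum_(i <= k < i + j) u k <= B (i + j))%N) ->
  survives r i U f.
Proof.
elim: r i U => //= r IH i U uf AuB.
have [ufi ubi] := uf i ltac:(lia).
have := AuB 1%N isT; rewrite addn1 big_nat1 => /andP[A1 B1].
have le : (U + u i <= greedy_step f i U)%N by rewrite /greedy_step; lia.
rewrite (leq_trans A1 le) /=; apply: (@survives_mono _ _ (U + u i) _ f) => //.
apply: IH => j jr; first by apply: uf; lia.
have := AuB j.+1 jr; rewrite addnS big_ltn ?addSn; last by lia.
by rewrite addnA.
Qed.

(** The increments of the greedy run are the exponent; they are nonnegative because [B] is
    monotone. *)
Lemma survives_exponent r i U f : (forall j, (i <= j < i + r)%N -> (B j <= B j.+1)%N) ->
  (A i <= U <= B i)%N -> survives r i U f ->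
  exists2 u, (forall j, (i <= j < i + r)%N -> (u j <= f j)%N /\ (u j <= b j)%N) &
    (forall j, (j <= r)%N -> (A (i + j) <= U + \sum_(i <= k < i + j) u k <= B (i + j))%N).
Proof.
elim: r i U => [|r IH] i U Bm AUB /=.
  exists (fun=> 0%N) => [j|j]; first lia.
  by rewrite leqn0 => /eqP->; rewrite addn0 big_geq // addn0.
case/andP=> Ag sg; set V := greedy_step f i U in Ag sg.
have UV : (U <= V)%N.
  by have := Bm i ltac:(lia); rewrite /V /greedy_step; lia.
have VB : (V <= B i.+1)%N by rewrite /V /greedy_step; lia.
have [||u ufb AuB] := IH i.+1 V _ _ sg; first by move=> j ij; apply: Bm; lia.
  by rewrite Ag.
exists (fun j => if j == i then V - U else u j)%N => [j ij|[|j] jr].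
- case: eqP => [->|ji]; last by apply: ufb; lia.
  by rewrite /V /greedy_step; lia.
- by rewrite addn0 big_geq // addn0.
rewrite big_ltn ?eqxx; last by lia.
rewrite -addSnnS /=; have := AuB j jr.
suff -> : \sum_(i.+1 <= k < i.+1 + j) (if k == i then (V - U)%N else u k) =
   \sum_(i.+1 <= k < i.+1 + j) u k by rewrite addnA subnKC.
by apply: eq_big_nat => k ik; case: eqP => //; lia.
Qed.

Lemma survives_bound r i U f : survives r i U f -> (0 < r)%N ->
  (A (i + r) <= U + \sum_(i <= k < i + r) f k)%N.
Proof.
elim: r i U => //= r IH i U /andP[Ag sg] _.
have gle : (greedy_step f i U <= U + f i)%N by rewrite /greedy_step; lia.
case: r IH sg => [|r] IH sg.
  by rewrite addn1 big_nat1 (leq_trans Ag).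
have := IH _ _ sg isT; rewrite addSnnS => /leq_trans; apply.
rewrite [X in (_ <= _ + X)%N]big_ltn; last by lia.
by rewrite addnA leq_add2r.
Qed.

End Greedy.

(** * Lattice path ideals and their filtration *)

Section PathIdeal.
Variables (K : fieldType) (n : nat).
Notation S := {mpoly K[n]}.

Definition path_pred A B b : pred 'X_{1..n} :=
  fun m => survives A B b n 0 0 (nth 0%N m).

Definition path_ideal A B b : S -> Prop := mono_ideal (path_pred A B b).

Lemma nth_mnmD (m m' : 'X_{1..n}) j :
  nth 0%N (m + m')%MM j = (nth 0 m j + nth 0 m' j)%N.
Proof.
case: (ltnP j n) => [jn|nj]; last by rewrite !nth_default ?size_tuple.
by rewrite -!(mnm_nth 0%N _ (Ordinal jn)) mnmDE.
Qed.

Lemma nth_mnm1 (i : 'I_n) j : nth 0%N (U_(i)%MM : 'X_{1..n}) j = (j == i :> nat).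
Proof.
case: (ltnP j n) => [jn|nj].
  by rewrite -(mnm_nth 0%N _ (Ordinal jn)) mnm1E -val_eqE eq_sym.
by rewrite nth_default ?size_tuple // gtn_eqF // (leq_trans (ltn_ord i)).
Qed.

Lemma upset_path_pred A B b : upset (path_pred A B b).
Proof.
move=> m m'; apply: survives_mono => // j _.
by rewrite nth_mnmD leq_addr.
Qed.

Lemma path_idealP A B b : is_ideal (path_ideal A B b).
Proof. exact: mono_idealP (@upset_path_pred A B b). Qed.

Lemma weakly_regular_total (J : S -> Prop) fs : (forall g, J g) -> weakly_regular J fs.
Proof.
elim: fs J => //= f fs IH J JT; split=> //; apply: IH => g.
exact: sub_ideal_add1.
Qed.

(* Peeling off the powers of the variables one by one filters [S/J] by
   quotients [S/(x_z, z \in Z)], indexed by the runs of the greedy algorithm: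
   [Z] collects the variables [x_i] in which the run stays strictly below the
   greedy maximum, and the variable in which it falls below [A]. *)
Lemma path_ideal_regular (A B b : nat -> nat) (fs : seq S)
    (Inv : {set 'I_n} -> nat -> nat -> Prop) :
  lattice_path_data n A B b ->
  (forall Z (i : 'I_n) U, Inv Z i U -> Inv Z i.+1 (minn (U + b i) (B i.+1))) ->
  (forall Z (i : 'I_n) U a, Inv Z i U -> (A i.+1 <= U + a)%N ->
     (U + a < minn (U + b i) (B i.+1))%N -> Inv (i |: Z) i.+1 (U + a)%N) ->
  (forall Z (i : 'I_n) U, Inv Z i U -> (A i <= U <= B i)%N ->
     weakly_regular (mono_ideal (vars_upset (i |: Z))) fs) ->
  Inv set0 0 0 ->
  weakly_regular (path_ideal A B b) fs.
Proof.
move=> lp freeI killI deadI Inv0.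
suff gen r i U Z : (i + r = n)%N -> (A i <= U <= B i)%N -> Inv Z i U ->
    (forall z, z \in Z -> (z < i)%N) ->
    weakly_regular (mono_ideal (fun m => vars_upset Z m || survives A B b r i U (nth 0%N m))) fs.
  have := gen n 0%N 0%N set0; rewrite (lpd_A0 lp) (lpd_B0 lp) => /(_ erefl isT Inv0).
  have H0 z : z \in (set0 : {set 'I_n}) -> (z < 0)%N by rewrite inE.
  move=> /(_ H0); apply: weakly_regular_iff; apply: mono_ideal_iff => m.
  rewrite /path_pred; case: (vars_upset set0 m) / exists_inP => // -[z].
  by rewrite inE.
elim: r i U Z => [|r IH] i U Z ir AUB InvZ Zi.
  (* No step is left, so the ideal is the whole ring. *)
  by apply: weakly_regular_total => g m _; rewrite orbT.
have iltn : (i < n)%N by lia.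
pose io := Ordinal iltn; set M := minn (U + b i) (B i.+1).
have UM : (U <= M)%N by have := lpd_B_mono lp iltn; rewrite /M; lia.
have AM : (A i.+1 <= M)%N.
  have := lpd_AB lp iltn; have := lpd_A_step lp iltn; rewrite /M; lia.
have ioZ : io \notin Z by apply/negP => /Zi; rewrite /= ltnn.
(* [P a] belongs to the colon ideal by [x_i ^ a]. For [a = M - U] the run reaches [M] whatever the
   exponent of [x_i]; the induction descends from there to [a = 0]. *)
pose P a := fun m : 'X_{1..n} => vars_upset Z m ||
  survives A B b r.+1 i U (fun j => nth 0%N m j + (j == i) * a)%N.
suff HP k : (k <= M - U)%N -> weakly_regular (mono_ideal (P (M - U - k)%N)) fs.
  have := HP (M - U)%N (leqnn _); apply: weakly_regular_iff; apply: mono_ideal_iff => m.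
  rewrite /P subnn; congr (_ || _); apply: survives_eq => j _; lia.
have tailE (m : 'X_{1..n}) a V :
    survives A B b r i.+1 V (fun j => nth 0%N m j + (j == i) * a)%N =
    survives A B b r i.+1 V (nth 0%N m).
  by apply: survives_eq => j ij; rewrite gtn_eqF // addn0.
have varsU a (m : 'X_{1..n}) : vars_upset (a |: Z) m = (0 < m a)%N || vars_upset Z m.
  apply/exists_inP/orP => [[z /setU1P[->|zZ] mz]|[ma|/exists_inP[z zZ mz]]].
  - by left.
  - by right; apply/exists_inP; exists z.
  - by exists a => //; rewrite setU11.
  - by exists z => //; rewrite setU1r.
elim: k => [|k IHk] kM.
  have := IH i.+1 M Z ltac:(lia); rewrite AM geq_minr => /(_ isT (freeI Z io U InvZ)).
  have Zi1 z : z \in Z -> (z < i.+1)%N by move/Zi; lia.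
  move=> /(_ Zi1); apply: weakly_regular_iff; apply: mono_ideal_iff => m.
  rewrite /P /= tailE subn0.
  have -> : greedy_step B b (fun j => nth 0 m j + (j == i) * (M - U))%N i U = M.
    by rewrite /greedy_step eqxx /M; lia.
  by rewrite AM.
set a := (M - U - k.+1)%N; have aM : (U + a < M)%N by rewrite /a; lia.
have aE : (M - U - k)%N = a.+1 by rewrite /a; lia.
have upP : upset (P a).
  move=> m m' /orP[mZ|sm]; apply/orP; first by left; apply: vars_upsetP.
  right.
  by apply: survives_mono sm => // j _; rewrite nth_mnmD; lia.
apply: (@weakly_regular_step _ _ _ io) => //.
  have := IHk (ltnW kM); rewrite aE; apply: weakly_regular_iff; apply: mono_ideal_iff => m.
  rewrite /P; congr (_ || _).
    apply/exists_inP/exists_inP => -[z zZ mz]; exists z => //.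
      by rewrite mnmDE addn_gt0 mz.
    move: mz; rewrite mnmDE mnm1E; case: eqP => [zio|]; last by rewrite addn0.
    by rewrite zio zZ in ioZ.
  by apply: survives_eq => j _; rewrite nth_mnmD nth_mnm1 /=; case: eqP => _; lia.
(* Adding [x_i] to the ideal fixes the contribution of this variable at [a]: the run goes on from
   [U + a] or, if this is below [A i.+1], dies and leaves the ideal of the variables in
   [io |: Z]. *)
have [AUa|AUa] := leqP (A i.+1) (U + a).
  have := IH i.+1 (U + a)%N (io |: Z) ltac:(lia).
  have UaB : (U + a <= B i.+1)%N by rewrite /M in aM; lia.
  rewrite AUa UaB => /(_ isT (killI Z io U a InvZ AUa aM)).
  have Zi1 z : z \in io |: Z -> (z < i.+1)%N.
    by case/setU1P=> [->|/Zi] /=; lia.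
  move=> /(_ Zi1); apply: weakly_regular_iff; apply: mono_ideal_iff => m.
  rewrite varsU /P /= tailE.
  have [mi|mi] := posnP (m io); last by rewrite orbT.
  rewrite orFb orbF; congr (_ || _).
  have mi0 : nth 0%N m i = 0%N by rewrite -[i]/(val io) -mnm_nth.
  have -> : greedy_step B b (fun j => nth 0 m j + (j == i) * a)%N i U = (U + a)%N.
    by rewrite /greedy_step eqxx mi0; rewrite /M in aM; lia.
  by rewrite AUa.
have := deadI Z io U InvZ AUB; apply: weakly_regular_iff; apply: mono_ideal_iff => m.
rewrite varsU /P /=.
have [mi|mi] := posnP (m io); last by rewrite orbT.
have mi0 : nth 0%N m i = 0%N by rewrite -[i]/(val io) -mnm_nth.
have -> : greedy_step B b (fun j => nth 0 m j + (j == i) * a)%N i U = (U + a)%N.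
  by rewrite /greedy_step eqxx mi0; rewrite /M in aM; lia.
by rewrite leqNgt AUa /= !orbF.
Qed.

End PathIdeal.

(** * Regular sequences modulo lattice path ideals *)

Section RegularSequences.
Variables (K : fieldType) (n : nat).
Notation S := {mpoly K[n]}.
Implicit Types (A B b : nat -> nat).

Lemma separated_rcons (V : ('I_n -> K) -> Prop) (fs : seq S) f :
  separated V fs ->
  (exists v, [/\ V v, forall g, g \in fs -> g.@[v] = 0 & f.@[v] != 0]) ->
  separated V (rcons fs f).
Proof.
elim: fs V => [|g fs IH] V /=; first by move=> _ [v [Vv _ fv]]; split=> //; exists v.
move=> [gv sfs] [v [Vv fsv fv]]; split=> //; apply: IH => //.
exists v; split=> //; first by split=> //; apply: fsv; rewrite mem_head.
by move=> h hfs; apply: fsv; rewrite inE hfs orbT.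
Qed.

Lemma separated_sorted (V : ('I_n -> K) -> Prop) (F : nat -> S) cs : sorted ltn cs ->
  (forall i, i \in cs -> exists v, [/\ V v,
     forall j, j \in cs -> (j < i)%N -> (F j).@[v] = 0 & (F i).@[v] != 0]) ->
  separated V (map F cs).
Proof.
elim: cs V => //= i cs IH V srt H; split.
  by have [v [Vv _ Fv]] := H i (mem_head _ _); exists v.
have ics := order_path_min ltn_trans srt.
apply: IH => [|j jcs]; first exact: path_sorted srt.
have [|v [Vv Fl Fj]] := H j; first by rewrite inE jcs orbT.
exists v; split=> //.
  by split=> //; apply: Fl; rewrite ?mem_head // (allP ics).
by move=> j' j'cs; apply: Fl; rewrite inE j'cs orbT.
Qed.

Definition lform (a : nat -> K) : S := \sum_(j < n) a j *: 'X_j.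

Lemma linear_lform a : linear_form (lform a).
Proof. by exists (fun j => a j). Qed.

Lemma meval_lform a v : (lform a).@[v] = \sum_(j < n) a j * v j.
Proof. by rewrite raddf_sum; apply: eq_bigr => j _; rewrite /= mevalZ mevalXU. Qed.

(** With the variables numbered from 1, this is [x_i - x_(i+1)]. *)
Definition diff_form i : S := lform (fun j => (j == i.-1)%:R - (j == i)%:R).

Lemma sum_delta (g : nat -> K) i : (i < n)%N -> \sum_(j < n) (j == i :> nat)%:R * g j = g i.
Proof.
move=> iltn; rewrite (bigD1 (Ordinal iltn)) //= eqxx mul1r big1 ?addr0 // => j.
by rewrite -val_eqE /= => /negbTE->; rewrite mul0r.
Qed.

Lemma meval_diff_form i (g : nat -> K) : (0 < i < n)%N ->
  (diff_form i).@[fun j => g j] = g i.-1 - g i.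
Proof.
move=> iltn; rewrite meval_lform.
under eq_bigr do rewrite mulrBl.
by rewrite sumrB !sum_delta //; lia.
Qed.

Definition cuts A B : seq nat := [seq i <- iota 1 n.-1 | A i == B i].

Lemma mem_cuts A B i : (i \in cuts A B) = (0 < i < n)%N && (A i == B i).
Proof. by rewrite mem_filter mem_iota andbC; congr (_ && _); lia. Qed.

Lemma sorted_cuts A B : sorted ltn (cuts A B).
Proof. by apply: sorted_filter; [exact: ltn_trans | exact: iota_ltn_sorted]. Qed.

(* As a point of [K^n] its indicator annihilates [x_(j-1) - x_j] for all cuts
   [j < i], but not for [j = i]. *)
Definition chain A B i s : bool :=
  (s < i)%N && all (fun q => A q == B q) (iota s.+1 (i - s.+1)).

Lemma chain_cut A B i j : (0 < j < i)%N -> A j = B j -> chain A B i j.-1 = chain A B i j.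
Proof.
move=> ji Aj; rewrite /chain (ltn_predK (m := 0)) //; last by lia.
have -> : (i - j = (i - j.+1).+1)%N by lia.
by rewrite /= Aj eqxx; congr (_ && _); lia.
Qed.

Lemma chain_pred A B i : (0 < i)%N -> chain A B i i.-1.
Proof. by case: i => // i _; rewrite /chain /= ltnSn subnn. Qed.

Lemma chain_next A B i s : chain A B i s -> (s < i.-1)%N -> A s.+1 = B s.+1.
Proof.
case/andP=> si /allP H ss; apply/eqP/H; rewrite mem_iota; lia.
Qed.

Section Runs.
Variables (A B b : nat -> nat).
Hypothesis lp : lattice_path_data n A B b.

(** Invariant of the runs: [z] enters [Z] only if the sum at [z.+1] is at least [A] and less than
    [B] there, so [z.+1] is no cut. *)
Definition noncut_below (Z : {set 'I_n}) (i : nat) :=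
  forall z, z \in Z -> (z < i)%N /\ A z.+1 <> B z.+1.

(** For a cut [i <= t] the point is the indicator of the chain ending at [i]: its variables directly
    precede cuts and so avoid [Z]. For [i > t] the coordinate [i] alone lies beyond [t] and [Z]. *)
Lemma diff_forms_separated (Z : {set 'I_n}) (t : 'I_n) : noncut_below Z t ->
  separated (fun v : 'I_n -> K => forall z, z \in t |: Z -> v z = 0)
    (map diff_form (cuts A B)).
Proof.
move=> HZ; apply: separated_sorted; first exact: sorted_cuts.
move=> i; rewrite mem_cuts => /andP[iltn /eqP Ai].
have [it|ti] := leqP i t.
  exists (fun j => (chain A B i j)%:R); split.
  - move=> z; case: (boolP (chain A B i z)) => // cz /setU1P[zt|/HZ[zt]].
      by case/andP: cz; rewrite zt; lia.
    case; have [zi|] := ltnP z i.-1; first exact: (chain_next cz).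
    move=> iz; suff -> : z.+1 = i by [].
    by case/andP: cz; lia.
  - move=> j; rewrite mem_cuts => /andP[jltn /eqP Aj] ji.
    rewrite (meval_diff_form (fun s => (chain A B i s)%:R)) //.
    by rewrite chain_cut ?subrr //; lia.
  - rewrite (meval_diff_form (fun s => (chain A B i s)%:R)) // chain_pred; last by lia.
    by rewrite /chain ltnn /= subr0 oner_neq0.
exists (fun j => (j == i :> nat)%:R); split.
- move=> z /setU1P[->|/HZ[zt _]]; first by rewrite ltn_eqF.
  by rewrite ltn_eqF // (ltn_trans zt).
- move=> j; rewrite mem_cuts => /andP[jltn _] ji.
  rewrite (meval_diff_form (fun s => (s == i)%:R)) //.
  by rewrite !ltn_eqF ?subrr //; lia.
- rewrite (meval_diff_form (fun s => (s == i)%:R)) // eqxx ltn_eqF ?sub0r ?oppr_eq0 ?oner_neq0 //.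
  lia.
Qed.

Lemma noncut_free Z (i : 'I_n) : noncut_below Z i -> noncut_below Z i.+1.
Proof. by move=> HZ z /HZ[zi ?]; split=> //; apply: ltnW. Qed.

Lemma noncut_kill Z (i : 'I_n) U : noncut_below Z i -> (A i.+1 <= U)%N ->
  (U < B i.+1)%N -> noncut_below (i |: Z) i.+1.
Proof.
move=> HZ AU UB z /setU1P[->|/HZ[zi ?]]; split=> //; last exact: ltnW.
by lia.
Qed.

Lemma diff_forms_linear f : f \in map diff_form (cuts A B) -> linear_form f.
Proof. by case/mapP=> i _ ->; apply: linear_lform. Qed.

Lemma diff_forms_regular : weakly_regular (@path_ideal K n A B b) (map diff_form (cuts A B)).
Proof.
apply: (path_ideal_regular (Inv := fun Z i _ => noncut_below Z i) lp).
- by move=> Z i _; apply: noncut_free.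
- by move=> Z i U a HZ AU UB; apply: (noncut_kill (U := U + a)%N); rewrite //; lia.
- move=> Z i _ HZ _; apply: vars_regular; first exact: diff_forms_linear.
  exact: diff_forms_separated.
- by move=> z; rewrite inE.
Qed.

(** With the variables numbered from 1, this is [x_p + ... + x_n]. *)
Definition tail_form (p : nat) : S := lform (fun j => (p.-1 <= j)%N%:R).

Lemma tail_form_regular p : (0 < p < n)%N ->
  (forall i, (p <= i < n)%N -> (A i < B i)%N) ->
  (B p + \sum_(p <= j < n) b j < A n + (n - p))%N ->
  weakly_regular (@path_ideal K n A B b) (rcons (map diff_form (cuts A B)) (tail_form p)).
Proof.
move=> pn Hp Hlt.
(* If all of [x_(p-1), ..., x_(i-1)], numbered from 0, are in [Z], each of them has cost at least
   one unit against the largest possible sum. *)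
pose tight Z i U := (p <= i)%N -> (forall j : 'I_n, (p.-1 <= j < i)%N -> j \in (Z : {set 'I_n})) ->
  (U + (i - p) + 1 <= B p + \sum_(p <= j < i) b j)%N.
apply: (path_ideal_regular (Inv := fun Z i U => noncut_below Z i /\ tight Z i U) lp).
- move=> Z i U [HZ _]; split; first exact: noncut_free.
  move=> pi /(_ i) iZ; have /HZ[] : i \in Z by apply: iZ; lia.
  by rewrite ltnn.
- move=> Z i U a [HZ HT] AU UB; split.
    by apply: (noncut_kill (U := U + a)%N); rewrite //; lia.
  move=> pi jZ; have [ip|{}pi] := ltnP i p.
    have ->: p = i.+1 by lia.
    by rewrite big_geq // subnn; lia.
  have /(HT pi) : forall j : 'I_n, (p.-1 <= j < i)%N -> j \in Z.
    move=> j ji; have /setU1P[ji'|//] : j \in i |: Z by apply: jZ; lia.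
    by move: ji; rewrite ji' ltnn andbF.
  rewrite big_nat_recr //=; lia.
- move=> Z i U [HZ HT] AUB; apply: vars_regular.
    by move=> f; rewrite mem_rcons inE => /predU1P[->|/diff_forms_linear//]; exact: linear_lform.
  apply: separated_rcons; first exact: diff_forms_separated.
  have cutp j : j \in cuts A B -> (0 < j < p)%N /\ A j = B j.
    rewrite mem_cuts => /andP[jn /eqP Aj]; split=> //.
    by have [//|pj] := ltnP j p; [lia | have := Hp j; lia].
  (* A variable [q >= p] outside [i |: Z] gives a coordinate point on which all difference forms
     vanish, since every cut is below [p]. *)
  have [[q pq qZ]|noq] : {q : 'I_n | (p <= q)%N & q \notin i |: Z} +
      (forall q : 'I_n, (p <= q)%N -> q \in i |: Z).
    have [q /andP[]|H] := pickP [pred q : 'I_n | (p <= q)%N & q \notin i |: Z].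
      by left; exists q.
    by right=> q pq; have := H q; rewrite /= pq /= => /negbFE.
    exists (fun j => (j == q :> nat)%:R); split.
    + by move=> z; case: eqP => // /val_inj-> qZ'; rewrite qZ' in qZ.
    + move=> _ /mapP[j /cutp[jp _] ->].
      rewrite (meval_diff_form (fun s => (s == q)%:R)); last by lia.
      by rewrite !ltn_eqF ?subrr //; lia.
    + rewrite meval_lform; under eq_bigr do rewrite mulrC.
      rewrite (sum_delta (fun j => (p.-1 <= j)%N%:R)) //.
      by rewrite (leq_trans (leq_pred p) pq) oner_neq0.
  have nn : (n.-1 < n)%N by lia.
  have in1 : i = n.-1 :> nat.
    have /setU1P[<- //|/HZ[/=]] := noq (Ordinal nn) ltac:(rewrite /=; lia).
    have := ltn_ord i; lia.
  have pn1 : (p.-1 < n)%N by lia.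
  pose p1 := Ordinal pn1.
  have [p1Z|p1Z] := boolP (p1 \in i |: Z).
    (* With [x_(p-1)] gone too, [tight] at [i = n.-1] and [A n <= A i + b i] contradict [Hlt]. *)
    have /(HT ltac:(lia)) : forall j : 'I_n, (p.-1 <= j < i)%N -> j \in Z.
      move=> j /andP[pj ji]; have /setU1P[ji'|//] : j \in i |: Z.
        have [pj'|jp] := leqP p j; first exact: noq.
        suff -> : j = p1 by [].
        by apply: val_inj; rewrite /=; lia.
      by rewrite ji' ltnn in ji.
    have := lpd_A_step lp (ltn_ord i).
    have iE : i.+1 = n by lia.
    have SE : \sum_(p <= j < n) b j = (\sum_(p <= j < i) b j + b i)%N.
      by rewrite -{1}iE big_nat_recr //; lia.
    have AE : A n = A i.+1 by rewrite iE.
    by move: Hlt; rewrite SE AE => *; exfalso; lia.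
  (* The chain ending at [p] avoids [i |: Z] and meets the tail form only in [x_(p-1)]. *)
  exists (fun j => (chain A B p j)%:R); split.
  + move=> z; case: (boolP (chain A B p z)) => // cz /setU1P[zi|/[dup] zZ /HZ[zi]].
      by case/andP: cz; rewrite zi in1; lia.
    case; have [zi'|pz] := ltnP z p.-1; first exact: (chain_next cz).
    case/negP: p1Z; suff -> : p1 = z by rewrite setU1r.
    by apply: val_inj; case/andP: cz => /=; lia.
  + move=> _ /mapP[j /cutp[jp Aj] ->].
    rewrite (meval_diff_form (fun s => (chain A B p s)%:R)); last by lia.
    by rewrite chain_cut ?subrr.
  + rewrite meval_lform (bigD1 p1) //= leqnn mul1r chain_pred; last by lia.
    rewrite big1 ?addr0 ?oner_neq0 // => j; rewrite -val_eqE /= => jp.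
    case: (leqP p.-1 j) => pj; last by rewrite mul0r.
    rewrite /chain; have -> : (j < p)%N = false by lia.
    by rewrite mulr0.
- by split=> [z|]; [rewrite inE | rewrite /tight; lia].
Qed.

End Runs.

End RegularSequences.

(** * The Koszul class of a lattice path ideal *)

Section KoszulClass.
Variables (K : fieldType) (n : nat).
Notation S := {mpoly K[n]}.
Variables (A B b : nat -> nat).
Hypothesis lp : lattice_path_data n A B b.
Hypothesis n_gt0 : (0 < n)%N.

(** The largest [i <= j] that is 0 or satisfies [A i = B i]; blocks are named by their first
    variable. *)
Fixpoint block_start j : nat :=
  if j is j'.+1 then if A j == B j then j else block_start j' else 0%N.

Lemma block_start_le j : (block_start j <= j)%N.
Proof. by elim: j => //= j IH; case: ifP => // _; apply: ltnW. Qed.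

Lemma block_start_cut j : A (block_start j) = B (block_start j).
Proof.
by elim: j => [|j IH] /=; [rewrite (lpd_A0 lp) (lpd_B0 lp) | case: ifP => // /eqP].
Qed.

Lemma block_start_id j : A j = B j -> block_start j = j.
Proof. by case: j => //= j ->; rewrite eqxx. Qed.

Lemma block_start_max j i : (i <= j)%N -> A i = B i -> (i <= block_start j)%N.
Proof.
elim: j => [|j IH] /=; first by case: i.
rewrite leq_eqVlt => /predU1P[-> ->|ij Ai]; first by rewrite eqxx.
by case: ifP => // _; [apply: ltnW | apply: IH].
Qed.

(* The variable of a trivial block occurs in no generator; such a block enters
   the Koszul class with the form [e_j] instead of [x_j e_j]. *)
Definition nontrivial t := (B t < B t.+1)%N.

(** If [A t = B t = B t.+1], then [A t.+1] is squeezed to the same value; so [t.+1] ends the block,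
    which is a single variable. *)
Lemma trivial_block j : (j < n)%N -> ~~ nontrivial (block_start j) -> block_start j = j.
Proof.
move=> jn; rewrite /nontrivial -leqNgt => Bt; apply/eqP; rewrite eqn_leq block_start_le.
have [//|lt] := leqP; have st := block_start_cut j.
set t := block_start j in Bt lt st.
have tn : (t < n)%N by lia.
have := block_start_max lt; rewrite -/t ltnn => -> //.
have := lpd_AB lp tn; have := lpd_A_mono lp tn; lia.
Qed.

Lemma mem_starts t : (t \in 0%N :: cuts n A B) = (t < n)%N && (A t == B t).
Proof.
rewrite inE mem_cuts; case: t => [|t] //=.
by rewrite n_gt0 (lpd_A0 lp) (lpd_B0 lp).
Qed.

Lemma uniq_starts : uniq (0%N :: cuts n A B).
Proof.
by rewrite /= mem_cuts /=; apply: filter_uniq; apply: iota_uniq.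
Qed.

Lemma block_start_mem j : (j < n)%N -> block_start j \in 0%N :: cuts n A B.
Proof.
by move=> jn; rewrite mem_starts block_start_cut eqxx (leq_ltn_trans (block_start_le j)).
Qed.

Definition ord_of (t : nat) : 'I_n := insubd (Ordinal n_gt0) t.

Lemma ord_ofE t : (t < n)%N -> ord_of t = t :> nat.
Proof. by move=> tn; rewrite /ord_of val_insubd tn. Qed.

(** The partial sums of [w] times the first variable of every nontrivial block. The strict
    inequalities leave room for moving each of these variables to a later place in its block. *)
Variable Us : nat -> nat.
Hypothesis Us0 : Us 0 = 0%N.
Hypothesis Us_le : forall i, (i <= n)%N -> (Us i <= B i)%N.
Hypothesis Us_cut : forall i, (i <= n)%N -> A i = B i -> Us i = B i.
Hypothesis Us_noncut : forall i, (i < n)%N -> (A i < B i)%N -> (A i < Us i)%N.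
Hypothesis Us_start : forall i, (i < n)%N -> A i = B i ->
  (Us i + nontrivial i <= Us i.+1 <= Us i + b i)%N.
Hypothesis Us_step : forall i, (i < n)%N -> (A i < B i)%N -> (Us i <= Us i.+1 < Us i + b i)%N.

Definition start_weight j : nat := (A j == B j) && nontrivial j.

(** The exponent of [w]: the step of [Us] without the first variable of a nontrivial block. *)
Definition socle_entry j : nat := (Us j.+1 - Us j - start_weight j)%N.

Lemma Us_entry j : (j < n)%N -> (Us j + start_weight j + socle_entry j = Us j.+1)%N.
Proof.
move=> jn; rewrite /socle_entry /start_weight.
have [/eqP/(Us_start jn)|ABj] := boolP (A j == B j); first by rewrite /=; lia.
by have := Us_step jn; have := lpd_AB lp (ltnW jn); lia.
Qed.

Definition socle_mnm : 'X_{1..n} := [multinom socle_entry i | i < n].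

Definition block_mnm (f : nat -> 'I_n) : 'X_{1..n} :=
  (socle_mnm + \sum_(t <- 0%N :: cuts n A B | nontrivial t) U_(f t))%MM.

Lemma nth_mnm_sum (I : Type) (r : seq I) (P : pred I) (F : I -> 'X_{1..n}) j :
  nth 0%N (\sum_(i <- r | P i) F i)%MM j = (\sum_(i <- r | P i) nth 0 (F i) j)%N.
Proof.
elim/big_rec2: _ => [|i m k Pi <-]; last by rewrite nth_mnmD.
have [jn|nj] := ltnP j n; last by rewrite nth_default ?size_tuple.
by rewrite -(mnm_nth 0%N _ (Ordinal jn)) mnm0E.
Qed.

Lemma nth_block_mnm (f : nat -> 'I_n) j :
  (forall t, t \in 0%N :: cuts n A B -> block_start (f t) = t) -> (j < n)%N ->
  nth 0%N (block_mnm f) j =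
  (socle_entry j + (nontrivial (block_start j) && (f (block_start j) == j :> nat)))%N.
Proof.
move=> Hf jn; rewrite nth_mnmD nth_mnm_sum.
rewrite -[j in X in (X + _)%N]/(val (Ordinal jn)) -mnm_nth mnmE /=; congr (_ + _)%N.
under eq_bigr do rewrite nth_mnm1.
rewrite big_mkcond (bigD1_seq (block_start j)) ?uniq_starts ?block_start_mem //=.
rewrite big_seq_cond big1 ?addn0 => [|t /andP[tst tj]].
  by rewrite eq_sym; case: ifP.
case: ifP => // _; case: eqP => // jf.
by move: tj; rewrite -(Hf t tst) -jf eqxx.
Qed.

Lemma block_mnm_survives (f : nat -> 'I_n) :
  (forall t, t \in 0%N :: cuts n A B -> block_start (f t) = t) ->
  path_pred A B b (block_mnm f).
Proof.
move=> Hf.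
(* The variable of the current block is still to come at [i], so the run may lag behind [Us] by one;
   nothing is pending at cuts and at [n]. *)
pose pend i := [&& (0 < i)%N, nontrivial (block_start i.-1) & (i <= f (block_start i.-1))%N].
have pend0 i : (i <= n)%N -> (i == n) || (A i == B i) -> pend i = false.
  move=> ilen; case: i ilen => // i ilen H; rewrite /pend /=; apply/andP => -[_ ilef].
  case/orP: H => [/eqP iE|/eqP Ai].
    by have := ltn_ord (f (block_start i)); lia.
  have := block_start_max ilef Ai; rewrite Hf; last exact: block_start_mem.
  by have := block_start_le i; lia.
suff gen r i G : (i + r = n)%N -> (Us i <= G + pend i)%N ->
    survives A B b r i G (nth 0%N (block_mnm f)).
  by apply: gen; rewrite ?Us0.
elim: r i G => //= r IH i G ir UG.
have iltn : (i < n)%N by lia.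
set G' := greedy_step _ _ _ _ _.
pose ch := nontrivial (block_start i) && (f (block_start i) == i :> nat).
have pend'E : pend i.+1 = nontrivial (block_start i) && (i < f (block_start i))%N by [].
have UG1 : (Us i + start_weight i <= G + (ch + pend i.+1))%N.
  have -> : (ch + pend i.+1 = nontrivial (block_start i) && (i <= f (block_start i)))%N.
    rewrite pend'E /ch; case: (nontrivial _) => //=.
    by case: (ltngtP i (f (block_start i))).
  rewrite /start_weight; have [/eqP Ai|Ai] := boolP (A i == B i).
    have := UG; rewrite pend0 ?Ai ?eqxx ?orbT //; last exact: ltnW.
    rewrite (block_start_id Ai).
    have -> : (i <= f i)%N.
      rewrite -{1}(Hf i) ?block_start_le //; rewrite mem_starts iltn.
      by rewrite Ai eqxx.
    by rewrite andbT /=; lia.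
  move: UG; case: (i) Ai => [|i'] Ai /=; first by rewrite (lpd_A0 lp) (lpd_B0 lp) eqxx in Ai.
  by rewrite /pend /= (negbTE Ai); lia.
have vE : nth 0%N (block_mnm f) i = (socle_entry i + ch)%N by rewrite nth_block_mnm.
have vb : (nth 0%N (block_mnm f) i <= b i)%N.
  rewrite vE; have := Us_entry iltn.
  have [/eqP Ai|Ai] := boolP (A i == B i).
    have := Us_start iltn Ai; rewrite /start_weight Ai eqxx /= /ch (block_start_id Ai).
    by case: (nontrivial i) => /=; case: (nat_of_ord (f i) == i) => /=; lia.
  have lt : (A i < B i)%N by have := lpd_AB lp (ltnW iltn); lia.
  by have := Us_step iltn lt; case: ch vE UG1; lia.
have UG' : (Us i.+1 <= G' + pend i.+1)%N.
  have := Us_entry iltn; have := Us_le iltn.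
  rewrite /G' /greedy_step (minn_idPl vb) vE; lia.
rewrite IH ?addSnnS // andbT.
(* At a cut or at [n] the run has caught up with [Us = B]; elsewhere [A < Us] absorbs the lag. *)
have [cutS|ncut] := boolP ((i.+1 == n) || (A i.+1 == B i.+1)).
  move: UG'; rewrite pend0 // addn0 Us_cut //.
    by move=> BG; apply: leq_trans (lpd_AB lp iltn) BG.
  by case/orP: cutS => /eqP // ->; exact: lpd_last lp.
have ltn' : (i.+1 < n)%N by lia.
have lt : (A i.+1 < B i.+1)%N by have := lpd_AB lp iltn; lia.
have := Us_noncut ltn' lt; case: (pend i.+1) UG'; lia.
Qed.

Lemma ord_of_start t : t \in 0%N :: cuts n A B -> block_start (ord_of t) = t.
Proof.
by rewrite mem_starts => /andP[tn /eqP At]; rewrite ord_ofE // block_start_id.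
Qed.

(** The increments of [Us] telescope. So this monomial has the least degree [A n] possible in the
    ideal, and leaving out a variable takes it out. *)
Lemma sum_block_mnm : (\sum_(0 <= j < n) nth 0 (block_mnm ord_of) j = Us n)%N.
Proof.
transitivity (\sum_(0 <= j < n) (Us j.+1 - Us j))%N.
  apply: eq_big_nat => j /andP[_ jn]; rewrite nth_block_mnm //; last exact: ord_of_start.
  have := Us_entry jn.
  suff -> : nontrivial (block_start j) && (ord_of (block_start j) == j :> nat) =
    start_weight j :> nat by lia.
  rewrite ord_ofE ?(leq_ltn_trans (block_start_le j)) // andbC /start_weight.
  have [/eqP/block_start_id->|Aj] := boolP (A j == B j); first by rewrite eqxx.
  by case: eqP => // je; case/eqP: Aj; rewrite -je block_start_cut.
suff H i : (i <= n)%N -> (\sum_(0 <= j < i) (Us j.+1 - Us j) = Us i)%N by exact: H.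
elim: i => [_|i IH iltn]; first by rewrite big_geq ?Us0.
by rewrite big_nat_recr //= (IH (ltnW iltn)); have := Us_entry iltn; lia.
Qed.

Lemma path_koszul_class : nontrivial 0 ->
  koszul_class (fun i : 'I_n => 'X_i : S) (path_ideal A B b) (size (cuts n A B)).
Proof.
move=> nt0.
pose F t (j : 'I_n) : S :=
  if block_start j == t then if nontrivial t then 'X_j else 1 else 0.
pose s t : S := if nontrivial t then 1 else 'X_(ord_of t).
have prodE (f : nat -> 'I_n) : (forall t, t \in 0%N :: cuts n A B -> block_start (f t) = t) ->
    'X_[socle_mnm] * \prod_(t <- 0%N :: cuts n A B) F t (f t) = 'X_[block_mnm f] :> S.
  move=> Hf; rewrite /block_mnm mpolyXD; congr (_ * _).
  rewrite -mprodXE [RHS]big_mkcond big_seq [RHS]big_seq; apply: eq_bigr => t tst.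
  by rewrite /F Hf ?eqxx.
apply: (@koszul_class_prod _ _ K (mcoeff (block_mnm ord_of)) _ _ F s 'X_[socle_mnm] 0%N _ ord_of).
- exact: path_idealP.
- exact: uniq_starts.
- move=> i; rewrite (bigD1_seq (block_start i)) ?uniq_starts ?block_start_mem //=.
  rewrite big1 ?addr0 => [|t ti]; last by rewrite /F eq_sym (negbTE ti) mulr0.
  rewrite /s /F eqxx; case: ifPn => [_|triv]; first by rewrite mul1r.
  by rewrite mulr1 trivial_block //; congr 'X_ _; apply: val_inj; rewrite /= ord_ofE.
- move=> f; have [/allP Hf|] := boolP (all (fun t => block_start (f t) == t) (0%N :: cuts n A B)).
    have {}Hf t : t \in 0%N :: cuts n A B -> block_start (f t) = t by move/Hf/eqP.
    by rewrite prodE //; apply/mono_idealX/block_mnm_survives.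
  (* If some [f t] lies outside the block [t], the factor [F t (f t)] is zero. *)
  rewrite -has_predC => /hasP[t tst /= ft].
  rewrite (bigD1_seq t) ?uniq_starts //= /F (negbTE ft) mul0r mulr0.
  by case: (path_idealP K n A B b).
- move=> u t ust tst ut; rewrite /F ord_of_start //.
  by rewrite eq_sym (negbTE ut).
(* Otherwise [block_mnm ord_of] divided by [x_t] would lie in the ideal, but its degree is below
   [A n]. *)
- move=> t g tst Jg; apply/eqP; rewrite mcoeff_eq0; apply/negP.
  have -> : 'X_(ord_of t) * g = g * 'X_(ord_of t) by rewrite mulrC.
  rewrite (perm_mem (msuppMX _ _)) => /mapP[m' m'g mE].
  have := survives_bound (Jg m' m'g) n_gt0; rewrite !add0n (lpd_last lp).
  have := sum_block_mnm; rewrite Us_cut //; last exact: lpd_last lp.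
  move=> <-; rewrite mE.
  under eq_bigr do rewrite nth_mnmD nth_mnm1.
  rewrite big_split /= => le.
  suff : (0 < \sum_(0 <= i < n) (i == ord_of t :> nat))%N by move: le; lia.
  by rewrite (bigD1_seq (nat_of_ord (ord_of t))) ?mem_index_iota ?iota_uniq //= eqxx.
- rewrite prodE; last exact: ord_of_start.
  by rewrite /s nt0 mul1r [X in X != 0]mcoeffX eqxx oner_neq0.
Qed.

End KoszulClass.

(** * Depth of powers *)

(* From [p] on there are no cuts and the bounds come only from [b] and the
   total degree; before [p] the bounds [b] matter only at cuts. *)
Record free_tail (n : nat) (A B b : nat -> nat) (p : nat) : Prop := {
  tail_range : (0 < p <= n)%N;
  tail_head : forall j, (j < p)%N -> (A j < B j)%N -> (B j.+1 < B j + b j)%N;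
  tail_noncut : forall i, (p <= i < n)%N -> (A i < B i)%N;
  tail_pos : forall i, (p <= i < n)%N -> (0 < b i)%N;
  tail_A : forall i, (p <= i < n)%N ->
    (A i <= A p)%N \/ (A i + \sum_(i <= j < n) b j <= A n)%N;
  tail_B : forall i, (p <= i < n)%N -> B i = minn (A n) (B p + \sum_(p <= j < i) b j)
}.

Lemma free_tail_scale n A B b p l : (0 < l)%N -> free_tail n A B b p ->
  free_tail n (fun i => l * A i)%N (fun i => l * B i)%N (fun i => l * b i)%N p.
Proof.
move=> l0 [pn h1 h2 h3 h4 h5]; split=> // [j jp|i pi|i pi|i pi|i pi].
- by rewrite -mulnDr !ltn_pmul2l //; apply: h1.
- by rewrite ltn_pmul2l //; apply: h2.
- by rewrite muln_gt0 l0 h3.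
- rewrite -big_distrr -mulnDr /= !leq_pmul2l //; exact: h4.
- by rewrite h5 // minnMr mulnDr big_distrr.
Qed.

Section Depth.
Variables (K : fieldType) (n : nat).
Notation S := {mpoly K[n]}.

Lemma max_ideal_vars (f : S) : max_ideal f -> mono_ideal (vars_upset setT) f.
Proof.
apply: ideal_gen_sub; first exact: mono_idealP (@vars_upsetP n setT).
move=> _ [i ->]; apply/mono_idealX/exists_inP; exists i; first by rewrite inE.
by rewrite mnm1E eqxx.
Qed.

Section Path.
Variables (A B b : nat -> nat).
Hypothesis lp : lattice_path_data n A B b.
Hypothesis deg_gt0 : (0 < A n)%N.

Lemma path_degree_gt0 : (0 < n)%N.
Proof. by case: n lp deg_gt0 => // lp0; rewrite (lpd_A0 lp0). Qed.

Lemma path_ideal_proper (fs : seq S) : (forall f, f \in fs -> max_ideal f) ->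
  ~ ideal_adds (path_ideal A B b) fs 1.
Proof.
move=> fsM /(@ideal_adds_sub _ _ (mono_ideal (vars_upset setT))) H.
have : mono_ideal (vars_upset setT) (1 : S).
  apply: H; first exact: mono_idealP (@vars_upsetP n setT).
    move=> f Jf m /Jf sm; apply/exists_inP.
    have := survives_bound sm path_degree_gt0; rewrite !add0n => le.
    have [i mi|m0] := pickP (fun i : 'I_n => (0 < m i)%N); first by exists i.
    have := leq_trans deg_gt0 le.
    rewrite big_mkord big1 // => i _.
    by rewrite -mnm_nth; have := m0 i; case: (m i).
  by move=> f /fsM/max_ideal_vars.
move=> /(_ 0%MM); rewrite msupp1 mem_head => /(_ isT) /exists_inP[i _].
by rewrite mnm0E.
Qed.

Lemma path_regular_seq (fs : seq S) : (forall f, f \in fs -> linear_form f) ->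
  weakly_regular (path_ideal A B b) fs -> regular_seq (@max_ideal K n) (path_ideal A B b) fs.
Proof.
move=> lfs wr; apply/regular_seqP; first exact: path_idealP.
have fsM f : f \in fs -> max_ideal f by move/lfs/linear_form_max_ideal.
by split=> //; apply: path_ideal_proper.
Qed.

Variable p : nat.
Hypothesis ft : free_tail n A B b p.

(* The partial sums of the exponent of [w * \prod_t x_t], [t] ranging over the
   first variables of the nontrivial blocks, for the monomial [w] of the upper
   bound. *)
Definition socle_path i : nat :=
  if (i <= p)%N then B i else minn (A n) (B p + \sum_(p <= j < i) (b j).-1).

(** Beyond [p] the path takes only [(b j).-1] per step, to leave room for the block variable; the
    second inequality says that it still reaches [A n]. *)
Lemma path_class : (0 < B 1)%N -> (A n + (n - p) <= B p + \sum_(p <= j < n) b j)%N ->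
  koszul_class (fun i : 'I_n => 'X_i : S) (path_ideal A B b) (size (cuts n A B)).
Proof.
move=> B1 Hle; have [pn h1 h2 h3 h4 h5] := ft.
have sumE i k : (p <= i)%N -> (i <= k <= n)%N ->
    (\sum_(i <= j < k) b j = \sum_(i <= j < k) (b j).-1 + (k - i))%N.
  move=> pi; elim: k => [|k IH] ik; first by rewrite !big_geq //; lia.
  have [->|ik'] := eqVneq i k.+1; first by rewrite !big_geq ?subnn.
  have ltik : (i <= k)%N by lia.
  rewrite !big_nat_recr //= IH; last by lia.
  have := h3 k ltac:(lia); lia.
have catE i : (p <= i <= n)%N ->
    (\sum_(p <= j < n) b j = \sum_(p <= j < i) b j + \sum_(i <= j < n) b j)%N.
  by move=> pi; rewrite -big_cat_nat //=; lia.
have ABn := lpd_last lp.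
have BE i : (p <= i <= n)%N -> B i = minn (A n) (B p + \sum_(p <= j < i) b j).
  move=> pi; have [iE|ne] := eqVneq i n; last by apply: h5; lia.
  by rewrite iE -ABn; apply/esym/minn_idPl; lia.
have Us_ge i : (p <= i <= n)%N ->
    socle_path i = minn (A n) (B p + \sum_(p <= j < i) (b j).-1).
  move=> pi; rewrite /socle_path; case: ifP => // ip.
  have iE : i = p by lia.
  by rewrite iE [LHS]BE ?big_geq // leqnn; case/andP: pn.
have n0 := path_degree_gt0.
have lt_np i : (i <= n)%N -> A i = B i -> (i <= p)%N \/ i = n.
  move=> ilen Ai; have [ip|pi] := leqP i p; first by left.
  right; apply/eqP; apply: contraT => ne.
  by have := h2 i ltac:(lia); rewrite Ai ltnn.
have Usn : socle_path n = B n.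
  rewrite Us_ge ?leqnn ?andbT; last by case/andP: pn.
  by rewrite -ABn; apply/minn_idPl; have := sumE p n (leqnn p) ltac:(lia); lia.
apply: (@path_koszul_class K n A B b lp n0 socle_path).
- by rewrite /socle_path leq0n (lpd_B0 lp).
- move=> i ilen; have [ip|pi] := leqP i p; first by rewrite /socle_path ip.
  have iin : (p <= i <= n)%N by lia.
  rewrite Us_ge // (BE i iin).
  have := sumE p i (leqnn p) iin; lia.
- move=> i ilen Ai; have [ip|->//] := lt_np i ilen Ai.
  by rewrite /socle_path ip.
- move=> i iltn ABi; have [ip|pi] := leqP i p; first by rewrite /socle_path ip.
  have iin : (p <= i <= n)%N by lia.
  rewrite Us_ge // leq_min; apply/andP; split.
    by apply: leq_trans ABi _; rewrite (BE i iin) geq_minl.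
  (* If [A i <= A p], then [A p < B p] gives strictness. Otherwise [A i] is at most the degree minus
     the remaining capacity, and [Hle] leaves [n - i > 0] units. *)
  have := h2 p ltac:(lia); have := catE i iin.
  have := sumE i n ltac:(lia) ltac:(lia); have := sumE p i (leqnn p) ltac:(lia).
  by case: (h4 i ltac:(lia)); lia.
- move=> i iltn Ai; have [ip|iE] := lt_np i (ltnW iltn) Ai; last by rewrite iE ltnn in iltn.
  have {}ip : (i < p)%N.
    rewrite ltn_neqAle ip andbT; apply/eqP => iE; have := h2 i.
    by rewrite iltn iE leqnn -iE Ai ltnn => /(_ isT).
  rewrite /socle_path ip (ltnW ip) /nontrivial.
  have := lpd_B_mono lp iltn; have := lpd_B_step lp iltn.
  by case: (ltnP (B i)) => /=; lia.
- move=> i iltn ABi; have [ip|pi] := ltnP i p.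
    by rewrite /socle_path ip (ltnW ip) (lpd_B_mono lp) //; apply: h1.
  have iin : (p <= i <= n)%N by lia.
  rewrite !Us_ge //; last by lia.
  rewrite big_nat_recr //=; have := h3 i ltac:(lia); have := BE i iin; lia.
- by rewrite /nontrivial (lpd_B0 lp).
Qed.

Lemma path_depth : (0 < B 1)%N -> (A n + (n - p) <= B p + \sum_(p <= j < n) b j)%N ->
  is_depth_quot (@path_ideal K n A B b) (size (cuts n A B)).
Proof.
move=> B1 Hle; split.
  exists (map (diff_form K n) (cuts n A B)); last by rewrite size_map.
  apply: path_regular_seq; last exact: diff_forms_regular.
  by move=> f; apply: diff_forms_linear.
have iJ := path_idealP K n A B b.
move=> fs /(regular_seqP _ _ iJ) [fsM wr _].
by apply: (koszul_class_bound iJ fsM wr); apply: path_class.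
Qed.

Lemma path_depth_gt : (B p + \sum_(p <= j < n) b j < A n + (n - p))%N ->
  exists2 fs, regular_seq (@max_ideal K n) (path_ideal A B b) fs &
    size fs = (size (cuts n A B)).+1.
Proof.
move=> Hlt; exists (rcons (map (diff_form K n) (cuts n A B)) (tail_form K n p)).
  apply: path_regular_seq.
    move=> f; rewrite mem_rcons inE => /predU1P[->|]; first exact: linear_lform.
    exact: diff_forms_linear.
  apply: tail_form_regular => //; last exact: tail_noncut ft.
  (* For [p = n] the hypothesis would read [B n < A n]. *)
  have := tail_range ft; rewrite [(p <= n)%N]leq_eqVlt.
  case/andP=> p0 /predU1P[pn|]; last by rewrite p0.
  by move: Hlt; rewrite pn big_geq // subnn (lpd_last lp); lia.
by rewrite size_rcons size_map.
Qed.

End Path.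

End Depth.

(** * Powers as dilations of the path data *)

Section Powers.
Variables (K : fieldType) (n : nat).
Notation S := {mpoly K[n]}.
Variables (A B b : nat -> nat).
Hypothesis lp : lattice_path_data n A B b.

Definition path_gen_ideal : S -> Prop :=
  ideal_gen (fun f => exists2 u : 'X_{1..n}, path_exponent n A B b (nth 0%N u) & f = 'X_[u]).

Definition scaled_pred l : pred 'X_{1..n} :=
  path_pred (fun i => l * A i)%N (fun i => l * B i)%N (fun i => l * b i)%N.

Lemma scaled_predP l (m : 'X_{1..n}) : reflect
  (exists2 u, path_exponent n (fun i => l * A i)%N (fun i => l * B i)%N (fun i => l * b i)%N u &
     forall j, (j < n)%N -> (u j <= nth 0%N m j)%N) (scaled_pred l m).
Proof.
have lpl := lattice_path_data_scale l lp.
apply: (iffP idP) => [|[u [Hs Hb] um]].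
  case/survives_exponent => [j||u ub AuB].
      by rewrite add0n; apply: lpd_B_mono lpl _.
    by rewrite (lpd_A0 lpl).
  exists u => [|j jn]; last by have [] := ub j jn.
  by split=> [i /AuB|j /ub[]]; rewrite ?add0n.
apply: (survives_path (u := u)) => j jn; first by rewrite um ?Hb.
by rewrite !add0n; apply: Hs.
Qed.

Lemma scaled_predD k l m1 m2 : scaled_pred k m1 -> scaled_pred l m2 ->
  scaled_pred (k + l) (m1 + m2)%MM.
Proof.
move=> /scaled_predP[u [us ub] um] /scaled_predP[v [vs vb] vm].
apply/scaled_predP; exists (fun j => u j + v j)%N => [|j jn]; last first.
  by rewrite nth_mnmD leq_add ?um ?vm.
split=> [i ilen|j jn]; last by rewrite mulnDl leq_add ?ub ?vb.
by rewrite big_split /= !mulnDl; have := us i ilen; have := vs i ilen; lia.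
Qed.

(** Hermite's identity: passing from [U] to [U + 1] drops the term [floor(U / l)] and adds
    [floor((U + l) / l)], which is larger by one. *)
Lemma sum_divn_shift l U : (0 < l)%N -> (\sum_(0 <= t < l) (U + t) %/ l = U)%N.
Proof.
case: l => // l _; elim: U => [|U IH].
  by rewrite big_nat big1 // => t tl; rewrite add0n divn_small.
have E : (\sum_(0 <= t < l) (U.+1 + t) %/ l.+1 = \sum_(0 <= t < l) (U + t.+1) %/ l.+1)%N.
  by apply: eq_bigr => t _; rewrite addSnnS.
have E' : ((U.+1 + l) %/ l.+1 = (U %/ l.+1).+1)%N by rewrite addSnnS divnDr // divnn addn1.
by move: IH; rewrite big_nat_recl // big_nat_recr //= E E' addn0; lia.
Qed.

(* Integer decomposition: the partial sums [U] of an exponent of the [l]-th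
   dilation split as [\sum_(t < l) floor ((U + t) / l)]. *)
Lemma path_exponent_split l (u : nat -> nat) : (0 < l)%N ->
  path_exponent n (fun i => l * A i)%N (fun i => l * B i)%N (fun i => l * b i)%N u ->
  exists v : 'I_l -> nat -> nat, (forall t, path_exponent n A B b (v t)) /\
    forall j, (j < n)%N -> (\sum_t v t j = u j)%N.
Proof.
move=> l0 [us ub]; pose U i := (\sum_(0 <= j < i) u j)%N.
have US i : U i.+1 = (U i + u i)%N by rewrite /U big_nat_recr.
pose v (t : 'I_l) j := ((U j.+1 + t) %/ l - (U j + t) %/ l)%N.
have vE (t : 'I_l) j : ((U j + t) %/ l + v t j = (U j.+1 + t) %/ l)%N.
  by rewrite /v subnKC // leq_div2r // US -addnA addnCA leq_addl.
have vs (t : 'I_l) i : (\sum_(0 <= j < i) v t j = (U i + t) %/ l)%N.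
  elim: i => [|i IH]; first by rewrite /U !big_geq // add0n divn_small.
  by rewrite big_nat_recr //= IH vE.
exists v; split=> [t|j jn].
  split=> [i /us|j jn].
    rewrite vs -/(U i) => /andP[AU UB].
    rewrite leq_divRL // mulnC (leq_trans AU) ?leq_addr //=.
    by rewrite -ltnS ltn_divLR // mulSn mulnC; have := ltn_ord t; lia.
  rewrite -(leq_add2l ((U j + t) %/ l)) vE [X in (_ <= X)%N]addnC -divnMDl // US mulnC.
  by apply: leq_div2r; have := ub j jn; lia.
apply/eqP; rewrite -(eqn_add2l (U j)) -US.
rewrite -{1}(sum_divn_shift (U j) l0) -(sum_divn_shift (U j.+1) l0) !big_mkord -big_split /=.
by apply/eqP; apply: eq_bigr => t _; rewrite vE.
Qed.

(** One inclusion adds exponents, the other splits an exponent of the [l]-th dilation into [l]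
    generators. *)
Lemma ideal_pow_path l f : (0 < l)%N ->
  ideal_pow path_gen_ideal l f <->
  path_ideal (fun i => l * A i)%N (fun i => l * B i)%N (fun i => l * b i)%N f.
Proof.
move=> l0; split.
  apply: ideal_gen_sub; first exact: path_idealP.
  suff gen (gs : seq S) : (forall g, g \in gs -> path_gen_ideal g) ->
      mono_ideal (scaled_pred (size gs)) (\prod_(g <- gs) g).
    by move=> _ [s [sI ->]]; have := gen s sI; rewrite size_tuple.
  elim: gs => [|g gs IH] sI m.
    by rewrite big_nil => _; apply/scaled_predP; exists (fun=> 0%N); split=> // i _; rewrite big1.
  rewrite big_cons => /msuppM_le/allpairsP[[m1 m2] /= [m1g m2gs ->]].
  apply: (@scaled_predD 1 (size gs)).
    suff : mono_ideal (scaled_pred 1) g by apply.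
    apply: ideal_gen_sub (sI g (mem_head _ _)); first exact: path_idealP.
    move=> _ [u pu ->]; apply/mono_idealX/scaled_predP; exists (nth 0%N u) => //.
    by case: pu => us ub; split=> [i /us|j /ub]; rewrite !mul1n.
  by apply: IH m2gs => h hgs; apply: sI; rewrite inE hgs orbT.
apply: mono_ideal_sub; first exact: ideal_genP.
move=> m /scaled_predP[u pu um].
have [v [vp vs]] := path_exponent_split l0 pu.
pose w t : 'X_{1..n} := [multinom v t i | i < n].
have wE t j : (j < n)%N -> nth 0%N (w t) j = v t j.
  by move=> jn; rewrite -[j]/(val (Ordinal jn)) -mnm_nth mnmE.
have wm : (\sum_t w t <= m)%MM.
  apply/mnm_lepP => i; rewrite mnm_sumE (mnm_nth 0%N).
  apply: leq_trans (um i (ltn_ord i)); rewrite -vs // leq_sum // => t _.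
  by rewrite mnmE.
rewrite -(submK wm) mpolyXD.
have [_ _ JM] := @ideal_genP S (fun f => exists s : l.-tuple S,
  (forall g, g \in s -> path_gen_ideal g) /\ f = \prod_(g <- s) g).
apply: JM; apply: mem_ideal_gen; exists [tuple 'X_[w t] | t < l]; split.
  move=> _ /mapP[t _ ->]; apply: mem_ideal_gen; exists (w t) => //.
  have [vps vpb] := vp t; split=> [i ilen|j jn]; last by rewrite wE ?vpb.
  have := vps i ilen; congr (_ <= _ <= _)%N; apply: eq_big_nat => j /andP[_ ji];
    by rewrite wE // (leq_trans ji).
by rewrite big_map big_enum -mprodXE.
Qed.

End Powers.

(** * From the depths of the powers to [dstab] *)

Section DepthStability.

Lemma ideal_gen_mono (R : comNzRingType) (G G' : R -> Prop) :
  (forall f, G f -> G' f) -> forall f, ideal_gen G f -> ideal_gen G' f.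
Proof. by move=> GG' f [s [Gs ->]]; exists s; split=> // p /Gs/GG'. Qed.

Lemma ideal_pow_iff (R : comNzRingType) (I I' : R -> Prop) l :
  (forall f, I f <-> I' f) -> forall f, ideal_pow I l f <-> ideal_pow I' l f.
Proof.
move=> II' f; split; apply: ideal_gen_mono => _ [s [sI ->]];
  by exists s; split=> // g /sI/II'.
Qed.

Lemma regular_seq_iff (R : comNzRingType) (M J J' : R -> Prop) fs :
  is_ideal J -> is_ideal J' -> (forall f, J f <-> J' f) ->
  regular_seq M J fs -> regular_seq M J' fs.
Proof.
move=> iJ iJ' JJ' /(regular_seqP _ _ iJ)[fsM wr J1].
apply/regular_seqP => //; split=> //; first exact: weakly_regular_iff wr.
move=> J'1; apply: J1; apply: ideal_adds_sub J'1; first exact: ideal_addsP.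
  by move=> g /JJ' Jg; apply: sub_ideal_adds.
by move=> f ffs; apply: mem_ideal_adds.
Qed.

Lemma is_depth_iff (R : comNzRingType) (M J J' : R -> Prop) r :
  is_ideal J -> is_ideal J' -> (forall f, J f <-> J' f) ->
  is_depth M J r -> is_depth M J' r.
Proof.
move=> iJ iJ' JJ' [[fs Hfs sz] Hr]; split.
  by exists fs => //; apply: regular_seq_iff Hfs.
by move=> gs Hgs; apply: Hr; apply: regular_seq_iff Hgs => // f; split=> /JJ'.
Qed.

(** For [l < m] a regular sequence of length [c + 1] rules out the stable value [c]. *)
Lemma is_dstab_intro (K : fieldType) (n : nat) (I : {mpoly K[n]} -> Prop) c m :
  (0 < m)%N ->
  (forall l, (m <= l)%N -> is_depth_quot (ideal_pow I l) c) ->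
  (forall l, (0 < l < m)%N -> exists2 fs, regular_seq (@max_ideal K n) (ideal_pow I l) fs &
     size fs = c.+1) ->
  is_dstab I m.
Proof.
move=> m0 stab unstab; split=> //; first by exists c.
move=> m' m'0 [r Hr]; rewrite leqNgt; apply/negP => m'm.
have rc : r = c by apply: is_depth_uniq (Hr m (ltnW m'm)) (stab m _).
have [|fs Hfs sz] := unstab m'; first by rewrite m'0.
have [_ /(_ fs Hfs)] := Hr m' (leqnn _).
by rewrite sz rc ltnn.
Qed.

Lemma is_dstab_iff (K : fieldType) (n : nat) (I I' : {mpoly K[n]} -> Prop) m :
  (forall f, I f <-> I' f) -> is_dstab I m -> is_dstab I' m.
Proof.
move=> II'.
have depE J J' l r : (forall f, J f <-> J' f) -> is_depth_quot (@ideal_pow {mpoly K[n]} J l) r ->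
    is_depth_quot (ideal_pow J' l) r.
  move=> JJ'; apply: is_depth_iff; try exact: ideal_genP.
  exact: ideal_pow_iff.
case=> m0 [r Hr] Hmin; split=> //; first by exists r => l /Hr; apply: depE.
move=> m' m'0 [s Hs]; apply: Hmin => //; exists s => l /Hs; apply: depE => f.
by split=> /II'.
Qed.

(** Dilation keeps the cuts, so their number is the stable depth; [m] is the first [l] for which the
    dilated data satisfy the inequality of [path_depth]. *)
Lemma path_dstab (K : fieldType) (n : nat) (A B b : nat -> nat) p m :
  lattice_path_data n A B b -> free_tail n A B b p -> (0 < A n)%N -> (0 < B 1)%N ->
  (0 < m)%N ->
  (forall l, (0 < l)%N -> (m <= l)%N =
     (l * A n + (n - p) <= l * (B p + \sum_(p <= j < n) b j))%N) ->
  is_dstab (@path_gen_ideal K n A B b) m.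
Proof.
move=> lp ft An B1 m0 mE.
have cutsE l : (0 < l)%N ->
    cuts n (fun i => l * A i)%N (fun i => l * B i)%N = cuts n A B.
  by move=> l0; apply: eq_filter => i; rewrite eqn_pmul2l.
have powE l f : (0 < l)%N -> path_ideal (fun i => l * A i)%N (fun i => l * B i)%N
    (fun i => l * b i)%N f <-> ideal_pow (@path_gen_ideal K n A B b) l f.
  by move=> l0; rewrite ideal_pow_path.
have iP l := path_idealP K n (fun i => l * A i)%N (fun i => l * B i)%N (fun i => l * b i)%N.
have ipow l : is_ideal (ideal_pow (@path_gen_ideal K n A B b) l) by exact: ideal_genP.
apply: (@is_dstab_intro _ _ _ (size (cuts n A B))) => // l.
  move=> ml; have l0 := leq_trans m0 ml.
  apply: is_depth_iff (iP l) (ipow l) (fun f => powE l f l0) _.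
  rewrite -(cutsE l l0); apply: (@path_depth K n _ _ _ _ _ p).
  - exact: lattice_path_data_scale.
  - by rewrite muln_gt0 l0.
  - exact: free_tail_scale.
  - by rewrite muln_gt0 l0.
  - by rewrite -big_distrr -mulnDr -mE.
case/andP=> l0 lm.
have [|||fs Hfs sz] := @path_depth_gt K n _ _ _ (lattice_path_data_scale l lp) _ p _ _.
- by rewrite muln_gt0 l0.
- exact: free_tail_scale.
- by rewrite -big_distrr -mulnDr ltnNge -mE // -ltnNge.
exists fs; last by rewrite sz cutsE.
by apply: regular_seq_iff (iP l) (ipow l) (fun f => powE l f l0) Hfs.
Qed.

End DepthStability.

(** * Right PLP-polymatroidal ideals *)

Section RightPLP.
Variables (n k d : nat) (alpha beta b : nat -> nat).
Hypothesis hPLP : right_PLP_data n k d alpha beta b.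

(* In the first [k] variables the bound [d] is implied by the total degree. *)
Definition PLP_bound j : nat := if (j < k)%N then d else b j.+1.

Definition PLP_tail i : nat := \sum_(i <= j < n) PLP_bound j.

(** From [k] on, the remaining variables add at most [PLP_tail i] to reach [d], while the bound
    [alpha k] persists. *)
Definition PLP_lower i : nat :=
  if i == 0%N then 0%N else if (i < k)%N then alpha i else maxn (alpha k) (d - PLP_tail i).

Definition PLP_upper i : nat :=
  if i == 0%N then 0%N else if (i <= k)%N then beta i
  else minn d (beta k + \sum_(k <= j < i) PLP_bound j).

Let kn : (0 < k < n)%N := PLP_k hPLP.

Lemma PLP_tailS i : (i < n)%N -> PLP_tail i = (PLP_bound i + PLP_tail i.+1)%N.
Proof. by move=> iltn; rewrite /PLP_tail big_ltn. Qed.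

Lemma PLP_tail_n : PLP_tail n = 0%N.
Proof. by rewrite /PLP_tail big_geq. Qed.

Lemma PLP_tail_k : PLP_tail k = bsum n k b.
Proof.
rewrite /PLP_tail /bsum big_add1 /=; apply: eq_big_nat => j /andP[kj _].
by rewrite /PLP_bound ltnNge kj.
Qed.

Lemma PLP_tail_cat i : (k <= i <= n)%N ->
  (\sum_(k <= j < i) PLP_bound j + PLP_tail i = bsum n k b)%N.
Proof. by move=> ki; rewrite -PLP_tail_k /PLP_tail -big_cat_nat //; lia. Qed.

Lemma PLP_bound_gt0 j : (k <= j < n)%N -> (0 < PLP_bound j)%N.
Proof.
move=> kj; rewrite /PLP_bound; have [jk|_] := ltnP j k; first by lia.
by apply: (PLP_b_gt0 hPLP); lia.
Qed.

Lemma PLP_tail_ge i : (k <= i <= n)%N -> (n - i <= PLP_tail i)%N.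
Proof.
move=> /andP[ki ilen]; rewrite /PLP_tail -[(n - i)%N]muln1 -sum_nat_const_nat.
rewrite big_nat [X in (_ <= X)%N]big_nat; apply: leq_sum => j ji.
by apply: PLP_bound_gt0; lia.
Qed.

Lemma PLP_lower_lt i : (0 < i < k)%N -> PLP_lower i = alpha i.
Proof. by rewrite /PLP_lower => /andP[i0 ->]; case: eqP i0 => // ->. Qed.

Lemma PLP_lower_ge i : (k <= i)%N -> PLP_lower i = maxn (alpha k) (d - PLP_tail i).
Proof. by move=> ki; rewrite /PLP_lower ltnNge ki; case: eqP => // i0; lia. Qed.

Lemma PLP_upper_le i : (0 < i <= k)%N -> PLP_upper i = beta i.
Proof. by rewrite /PLP_upper => /andP[i0 ->]; case: eqP i0 => // ->. Qed.

Lemma PLP_upper_ge i : (k <= i)%N ->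
  PLP_upper i = minn d (beta k + \sum_(k <= j < i) PLP_bound j).
Proof.
rewrite leq_eqVlt => /predU1P[<-|ki].
  rewrite PLP_upper_le ?leqnn ?andbT; last by lia.
  by rewrite big_geq // addn0; apply/esym/minn_idPr; apply: PLP_beta_d hPLP.
by rewrite /PLP_upper leqNgt ki; case: eqP => // i0; lia.
Qed.

Lemma PLP_lower_n : PLP_lower n = d.
Proof.
rewrite PLP_lower_ge ?PLP_tail_n ?subn0; last by lia.
by apply/maxn_idPr; apply: PLP_alpha_d hPLP.
Qed.

Lemma PLP_upper_n : PLP_upper n = d.
Proof.
rewrite PLP_upper_ge; last by lia.
apply/minn_idPl; have := PLP_tail_cat (i := n); rewrite PLP_tail_n addn0 leqnn => ->.
  exact: PLP_d_le hPLP.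
lia.
Qed.

Lemma PLP_beta1 i : (0 < i <= k)%N -> (0 < beta i)%N.
Proof.
move=> ik; apply: leq_trans (PLP_beta_gt0 hPLP) _.
by apply: (PLP_beta_mono hPLP); lia.
Qed.

Lemma PLP_path_data : lattice_path_data n PLP_lower PLP_upper PLP_bound.
Proof.
have ak := PLP_alpha_d hPLP; have bk := PLP_beta_d hPLP.
have abk := PLP_alpha_beta hPLP (i := k) ltac:(lia).
have dle := PLP_d_le hPLP.
have Bd i : (0 < i <= k)%N -> (beta i <= d)%N.
  by move=> ik; apply: leq_trans bk; apply: (PLP_beta_mono hPLP); lia.
split=> // [i ilen|i iltn|i iltn|i iltn|i iltn|].
- have [->//|i0] := posnP i.
  have [ik|ki] := ltnP i k.
    rewrite PLP_lower_lt ?PLP_upper_le ?i0 //; last exact: ltnW.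
    by apply: (PLP_alpha_beta hPLP); lia.
  rewrite PLP_lower_ge // PLP_upper_ge //.
  have := PLP_tail_cat (i := i) ltac:(lia); lia.
- have [->//|i0] := posnP i.
  have [ik|ki] := ltnP i.+1 k.
    rewrite !PLP_lower_lt //; last by lia.
    by apply: (PLP_alpha_mono hPLP); lia.
  rewrite (PLP_lower_ge ki).
  have [ik|ki'] := ltnP i k.
    rewrite PLP_lower_lt ?i0 //.
    have := PLP_alpha_mono hPLP (i := i) (j := k) ltac:(lia) ltac:(lia); lia.
  by rewrite PLP_lower_ge //; have := PLP_tailS iltn; lia.
- have [->//|i0] := posnP i.
  have [ik|ki] := ltnP i k.
    rewrite !PLP_upper_le ?i0 //=; last exact: ltnW.
    by apply: (PLP_beta_mono hPLP); lia.
  by rewrite !PLP_upper_ge ?(leqW ki) // big_nat_recr //=; lia.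
- have [ik|ki] := ltnP i k.
    have -> : PLP_bound i = d by rewrite /PLP_bound ik.
    apply: leq_trans (leq_addl _ _).
    have [ik'|ki] := ltnP i.+1 k.
      rewrite PLP_lower_lt //; apply: leq_trans ak.
      by apply: (PLP_alpha_mono hPLP); lia.
    by rewrite PLP_lower_ge //; lia.
  by rewrite !PLP_lower_ge ?(leqW ki) //; have := PLP_tailS iltn; lia.
- have [ik|ki] := ltnP i k.
    have -> : PLP_bound i = d by rewrite /PLP_bound ik.
    by apply: leq_trans (leq_addl _ _); rewrite PLP_upper_le //; apply: Bd; lia.
  by rewrite !PLP_upper_ge ?(leqW ki) // big_nat_recr //=; lia.
- by rewrite PLP_lower_n PLP_upper_n.
Qed.

(** Either the capacity has no slack or the first [k] variables exhaust the degree; in both cases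
    all [i] from [k] to [n] satisfy [A i = B i]. *)
Definition PLP_degenerate : bool := (d == beta k + bsum n k b)%N || (alpha k == d).

(** Outside the degenerate case this is [k + delta], as [k] is a cut exactly when
    [alpha k = beta k]. *)
Definition PLP_tail_start : nat :=
  if PLP_degenerate then n else if alpha k == beta k then k.+1 else k.

Lemma PLP_degenerate_cut j : PLP_degenerate -> (k <= j <= n)%N ->
  PLP_lower j = PLP_upper j.
Proof.
move=> deg kj; rewrite PLP_lower_ge ?PLP_upper_ge; try lia.
have := PLP_tail_cat kj; have := PLP_alpha_d hPLP; have := PLP_beta_d hPLP.
have := PLP_alpha_beta hPLP (i := k) ltac:(lia).
by case/orP: deg => /eqP; lia.
Qed.

Lemma PLP_free_tail : free_tail n PLP_lower PLP_upper PLP_bound PLP_tail_start.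
Proof.
have ak := PLP_alpha_d hPLP; have bk := PLP_beta_d hPLP.
have abk := PLP_alpha_beta hPLP (i := k) ltac:(lia).
have dle := PLP_d_le hPLP.
have head j : (j < k)%N -> (PLP_lower j < PLP_upper j)%N ->
    (PLP_upper j.+1 < PLP_upper j + PLP_bound j)%N.
  move=> jk; have [->//|j0] := posnP j => _.
  rewrite !PLP_upper_le ?j0 //=; last exact: ltnW.
  have -> : PLP_bound j = d by rewrite /PLP_bound jk.
  have := PLP_beta1 (i := j) ltac:(lia).
  have := PLP_beta_mono hPLP (i := j.+1) (j := k) isT ltac:(lia); lia.
rewrite /PLP_tail_start; case: ifPn => deg.
  split=> [|j jn AB|i|i|i|i]; try lia.
  have [jk|kj] := ltnP j k; first exact: head.
  by rewrite PLP_degenerate_cut ?ltnn // in AB; lia.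
move: deg; rewrite negb_or => /andP[/eqP dne /eqP ane].
have cutk : PLP_lower k = maxn (alpha k) (d - bsum n k b) by rewrite PLP_lower_ge // PLP_tail_k.
have upk : PLP_upper k = beta k by apply: PLP_upper_le; lia.
have noncut i : (k < i < n)%N -> (PLP_lower i < PLP_upper i)%N.
  move=> ki; rewrite PLP_lower_ge ?PLP_upper_ge; try lia.
  have := PLP_tail_cat (i := i) ltac:(lia); have := PLP_tail_ge (i := i) ltac:(lia).
  have := PLP_bound_gt0 (j := k) ltac:(lia).
  have : (PLP_bound k <= \sum_(k <= j < i) PLP_bound j)%N.
    by rewrite big_ltn ?leq_addr //; lia.
  lia.
have tailA p i : (k <= p <= i)%N -> (PLP_lower i <= PLP_lower p)%N \/
    (PLP_lower i + PLP_tail i <= PLP_lower n)%N.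
  move=> pi; rewrite PLP_lower_n !PLP_lower_ge; try lia.
case: ifPn => [/eqP ab|/eqP ab]; split=> [|j jp AB|i pi|i pi|i pi|i pi]; try lia.
- have [jk|kj] := ltnP j k; first exact: head.
  have jE : j = k by lia.
  by move: AB; rewrite jE cutk upk; lia.
- by apply: noncut; lia.
- by apply: PLP_bound_gt0; lia.
- by apply: tailA; lia.
- rewrite PLP_lower_n !PLP_upper_ge; try lia.
  rewrite (big_cat_nat (n := k.+1) (p := i)) /=; try lia.
- by apply: head.
- have [->|ik] := eqVneq i k; last by apply: noncut; lia.
  by rewrite cutk upk; lia.
- by apply: PLP_bound_gt0; lia.
- by apply: tailA; lia.
- by rewrite PLP_lower_n upk PLP_upper_ge //; lia.
Qed.

(** The additional bounds follow from the total degree [d] and the caps [b]. *)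
Lemma right_PLP_exponentE (u : 'X_{1..n}) :
  right_PLP_exponent k d alpha beta b u <->
  path_exponent n PLP_lower PLP_upper PLP_bound (nth 0%N u).
Proof.
have sumE i : (i <= n)%N -> (\sum_(j < n | (j < i)%N) u j = \sum_(0 <= j < i) nth 0 u j)%N.
  move=> ilen; rewrite big_mkord (big_ord_widen _ (nth 0%N u) ilen).
  by apply: eq_bigr => j _; rewrite -mnm_nth.
have sumn : (\sum_(j < n) u j = \sum_(0 <= j < n) nth 0 u j)%N.
  by rewrite big_mkord; apply: eq_bigr => j _; rewrite -mnm_nth.
split=> [[Hs Hb Hd]|[Hs Hb]].
  have bnd j : (k <= j < n)%N -> (nth 0 u j <= PLP_bound j)%N.
    move=> /andP[kj jn]; rewrite /PLP_bound ltnNge kj /=.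
    by have := Hb (Ordinal jn) kj; rewrite (mnm_nth 0%N).
  split=> [i ilen|j jn].
    have [->|i0] := posnP i; first by rewrite big_geq.
    have [ik|ki] := leqP i k.
      have := Hs i ltac:(lia); rewrite sumE // => /andP[al be].
      rewrite PLP_upper_le ?i0 // be andbT.
      have [ik'|ki] := ltnP i k; first by rewrite PLP_lower_lt ?i0.
      have iE : i = k by lia.
      rewrite PLP_lower_ge // geq_max -{1}iE al /= leq_subLR -Hd sumn.
      rewrite (big_cat_nat (n := i)) //= addnC leq_add2r /PLP_tail.
      by rewrite big_nat [X in (_ <= X)%N]big_nat; apply: leq_sum => j ji; apply: bnd; lia.
    have [/andP[alk bek]] : (alpha k <= \sum_(0 <= j < k) nth 0 u j <= beta k)%N.
      by rewrite -sumE; [apply: Hs|]; lia.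
    have splitk : (\sum_(0 <= j < i) nth 0 u j =
        \sum_(0 <= j < k) nth 0 u j + \sum_(k <= j < i) nth 0 u j)%N.
      by rewrite (big_cat_nat (n := k)) //=; lia.
    have spliti : (d = \sum_(0 <= j < i) nth 0 u j + \sum_(i <= j < n) nth 0 u j)%N.
      by rewrite -Hd sumn (big_cat_nat (n := i)).
    have le1 : (\sum_(k <= j < i) nth 0 u j <= \sum_(k <= j < i) PLP_bound j)%N.
      by rewrite big_nat [X in (_ <= X)%N]big_nat; apply: leq_sum => j ji; apply: bnd; lia.
    have le2 : (\sum_(i <= j < n) nth 0 u j <= PLP_tail i)%N.
      by rewrite /PLP_tail big_nat [X in (_ <= X)%N]big_nat; apply: leq_sum => j ji; apply: bnd; lia.
    by rewrite PLP_lower_ge ?PLP_upper_ge; lia.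
  have [jk|kj] := ltnP j k; last by apply: bnd; rewrite kj.
  rewrite /PLP_bound jk -Hd (bigD1 (Ordinal jn)) //= (mnm_nth 0%N) /=.
  exact: leq_addr.
split=> [i ik|j kj|].
- have := Hs i ltac:(lia); rewrite sumE; last by lia.
  rewrite PLP_upper_le; last by lia.
  have [ik'|ki] := ltnP i k; first by rewrite PLP_lower_lt //; lia.
  have iE : i = k by lia.
  by rewrite PLP_lower_ge // iE; lia.
- have := Hb j (ltn_ord j); rewrite -mnm_nth /PLP_bound ltnNge kj //.
- by have := Hs n (leqnn n); rewrite PLP_lower_n PLP_upper_n sumn; lia.
Qed.

Lemma right_PLP_idealE (K : fieldType) f :
  path_gen_ideal PLP_lower PLP_upper PLP_bound f <->
  right_PLP_ideal K n k d alpha beta b f.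
Proof.
by split; apply: ideal_gen_mono => _ [u /right_PLP_exponentE pu ->]; exists u.
Qed.

Lemma right_PLP_dstab (K : fieldType) m : (0 < m)%N ->
  (forall l, (0 < l)%N -> (m <= l)%N =
     (n - k - (alpha k == beta k) <= l * (beta k + bsum n k b - d))%N || PLP_degenerate) ->
  is_dstab (right_PLP_ideal K n k d alpha beta b) m.
Proof.
move=> m0 mE; apply: (is_dstab_iff (fun f => @right_PLP_idealE K f)).
apply: (@path_dstab K n _ _ _ PLP_tail_start) => //.
- exact: PLP_path_data.
- exact: PLP_free_tail.
- by rewrite PLP_lower_n (PLP_d hPLP).
- by rewrite PLP_upper_le ?PLP_beta1 //; lia.
move=> l l0; rewrite mE // PLP_lower_n /PLP_tail_start.
have bk := PLP_beta_d hPLP; have dle := PLP_d_le hPLP.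
case: ifPn => deg; first by rewrite orbT big_geq // PLP_upper_n subnn !addn0 leqnn.
rewrite orbF; case: ifPn => [ab|ab].
  rewrite -/(PLP_tail k.+1) PLP_upper_ge // big_nat1.
  have := PLP_tailS (i := k) ltac:(lia); rewrite PLP_tail_k => bE.
  have := PLP_tail_ge (i := k.+1) ltac:(lia) => tge.
  have [le|lt] := leqP (beta k + PLP_bound k) d.
    rewrite bE; apply/idP/idP; nia.
  (* Here the upper bound at [k.+1] is [d], and each of the [n - k.+1] later variables has cap at
     least 1; so both inequalities hold for every [l > 0]. *)
  rewrite mulnDr leq_add2l.
  have -> : (n - k.+1 <= l * PLP_tail k.+1)%N by nia.
  by rewrite bE; nia.
rewrite PLP_upper_le ?leqnn ?andbT; last by lia.
rewrite -/(PLP_tail k) PLP_tail_k subn0; apply/idP/idP; nia.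
Qed.

End RightPLP.

Theorem corollary6p6 (K : fieldType) (n k d : nat) (alpha beta b : nat -> nat)
    (hPLP : right_PLP_data n k d alpha beta b) :
  let I := right_PLP_ideal K n k d alpha beta b in
  let delta : int := Num.floor ((alpha k)%:R / (beta k)%:R : rat) in
  ((d = beta k + bsum n k b)%N -> is_dstab I 1)
  /\
  ((d < beta k + bsum n k b)%N ->
    exists2 m : nat, is_dstab I m &
      m%:Z = Num.max 1
        (Num.ceil ((n%:R - k%:R - delta%:~R)
                   / ((beta k)%:R + (bsum n k b)%:R - d%:R) : rat))).
Proof.
move=> I delta; split=> [dE|dlt].
  apply: right_PLP_dstab => // l l0.
  by rewrite l0 /PLP_degenerate dE eqxx orbT.
have kn := PLP_k hPLP.
have abk := PLP_alpha_beta hPLP (i := k) ltac:(lia).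
have bk0 : (0 < beta k)%N by apply: (PLP_beta1 hPLP); lia.
(* Since [alpha k <= beta k], the floor is 1 in case of equality and 0 otherwise. *)
have deltaE : delta = (alpha k == beta k)%:Z.
  apply: floor_def; have b0 : 0 < (beta k)%:R :> rat by rewrite ltr0n.
  rewrite ler_pdivlMr // ltr_pdivrMr //.
  have [->|ne] := eqVneq (alpha k) (beta k).
    by rewrite /= !mul1r lexx ltr_pMl // ltr1n.
  by rewrite mul0r ler0n mul1r ltr_nat ltn_neqAle ne.
set x : rat := _ / _.
(* The ceiling is 0 when [n = k + 1] and [delta = 1]; the maximum then gives 1. *)
pose m := absz (Num.max 1 (Num.ceil x)).
have m1 : 1 <= Num.max 1 (Num.ceil x) by rewrite le_max lexx.
have mZ : m%:Z = Num.max 1 (Num.ceil x) by rewrite /m gez0_abs // (le_trans _ m1).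
exists m => //; apply: right_PLP_dstab => // [|l l0].
  by rewrite -ltz_nat mZ (lt_le_trans _ m1).
rewrite -lez_nat mZ ge_max.
have -> : (1 <= l%:Z) by rewrite lez_nat.
rewrite ceil_le_int.
have xE : x = (n - k - (alpha k == beta k))%:R / (beta k + bsum n k b - d)%:R.
  rewrite /x deltaE; congr (_ / _).
    by rewrite -pmulrn !natrB //; lia.
  by rewrite natrB ?natrD // ltnW.
rewrite xE ler_pdivrMr ?ltr0n ?subn_gt0 //.
rewrite -[l%:~R]/(l%:R) -natrM ler_nat /PLP_degenerate.
have [//|gt] := leqP _ (l * _)%N.
rewrite /=; apply/esym/negbTE; rewrite negb_or; apply/andP; split; first by lia.
(* If [alpha k = d], then [beta k = d] and the slack is [bsum n k b >= n - k], contradicting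
   [gt]. *)
apply/eqP => ad; have bd := PLP_beta_d hPLP.
have := PLP_tail_ge hPLP (i := k) ltac:(lia); rewrite PLP_tail_k.
have bE : beta k = d by lia.
move: gt; rewrite bE addKn; nia.
Qed.
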